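(* Let $F=F(X)$ be a free group, let $H$ be a finitely generated subgroup of $F$, and let $N$ be a normal subgroup of $H$. Put $C=\operatorname{diam}(\Gamma(H)\dot\times\Gamma(H))+1$. If $\gamma_H(N)\ge 6C+2\operatorname{diam}(\Gamma(H))$, then $N=\langle\langle N\rangle\rangle_F\cap H$.
   Context: $\langle\langle N\rangle\rangle_F$ is the normal closure of $N$ in $F$. Elements of $F=F(X)$ are identified with reduced words in $X\cup X^{-1}$. An $X$-digraph $\Gamma$ is a directed graph (loops and multiple edges allowed) each of whose edges $e$ has an origin $o(e)$, a terminus $t(e)$ and a label in $X$. Each edge $e$ has a formal inverse $e^{-1}$ with $o(e^{-1})=t(e)$, $t(e^{-1})=o(e)$ and label the inverse of the label of $e$. A path is a finite (possibly empty) sequence of edges and inverses of edges, each starting where the previous one ends; its label is the product of the labels, its length the number of terms. A path is reduced if it contains no subpath of the form $e,e^{-1}$ (with $(e^{-1})^{-1}=e$). A cycle is a path from a vertex to itself. $\Gamma$ is folded if for every vertex $v$ and $x\in X$ there is at most one edge with origin $v$ and label $x$, and at most one edge with terminus $v$ and label $x$. The Stallings graph $\Gamma(H)$ is the unique (up to isomorphism) connected folded $X$-digraph with a marked vertex $1_H$ such that $H$ equals the set of labels of reduced cycles from $1_H$ to $1_H$ and every vertex other than $1_H$ has degree at least $2$ (it is finite since $H$ is finitely generated). The product $\Gamma(H)\times\Gamma(H)$ has as vertices the pairs of vertices of $\Gamma(H)$, and its edges labelled $x$ are the pairs $(e,e')$ of edges of $\Gamma(H)$ both labelled $x$, going from $(o(e),o(e'))$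 to $(t(e),t(e'))$. $\Gamma(H)\dot\times\Gamma(H)$ is obtained from it by removing the diagonal connected component, whose vertices are the $(v,v)$. For a finite graph $\Gamma$, $\operatorname{diam}(\Gamma)=\max\{d(u,v) : u,v \text{ vertices of } \Gamma,\ d(u,v)<\infty\}$, where $d(u,v)$ is the length of a shortest path from $u$ to $v$ ($\infty$ if there is none); the diameter of the empty graph is $0$. For a vertex $v$ of $\Gamma(H)$ let $H^v<F$ be the set of labels of the reduced cycles from $v$ to $v$ in $\Gamma(H)$ (a conjugate of $H$). Put $\Omega(H)=\{H^u\cap H^v\mid u,v \text{ vertices of }\Gamma(H),\ u\ne v\}$. For $w\in F$ let $|w|_H$ be the least $k\ge 0$ such that $w=w_1w_2\cdots w_k$ where each $w_i$ lies in $X\cup X^{-1}$ or in some member of $\Omega(H)$. For a normal subgroup $N$ of $H$ put $\gamma_H(N)=\min\{|w|_H : w\in N\setminus\{1\}\}$ (with $\gamma_H(\{1\})=+\infty$). *)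

(* Defs.v *)
From HB Require Import structures.
From mathcomp Require Import all_boot.
From mathcomp Require Import boolp classical_sets.

Set Implicit Arguments.
Unset Strict Implicit.
Unset Printing Implicit Defensive.

Local Open Scope classical_set_scope.
Local Open Scope group_scope.

(* Values in nat extended with +oo, which is encoded as [None]. *)

Definition min_ext (P : nat -> Prop) : option nat :=
  match pselect (exists n, `[< P n >]) with
  | left exP => Some (ex_minn exP)
  | right _ => None
  end.

Definition le_ext (n : nat) (m : option nat) : bool :=
  if m is Some k then n <= k else true.

Section Subgroups.
Variable G : groupType.
Implicit Types H N : set G.

Definition is_subgroup H : Prop :=
  [/\ H 1, forall x y, H x -> H y -> H (x * y) & forall x, H x -> H x^-1].

Definition is_normal_in N H : Prop :=
  [/\ is_subgroup N, N `<=` H & forall x h, N x -> H h -> N (x ^ h)].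

Definition finitely_generated H : Prop :=
  exists s : seq G, H = smallest is_subgroup [set` s].

Definition normal_closure N : set G :=
  smallest (fun M => is_normal_in M [set: G]) N.

End Subgroups.

(* A signed symbol [(a, true)] stands for a, and [(a, false)] for its formal
   inverse; this is used both for letters and for edges. *)

Section Signed.
Variable A : eqType.

Definition sinv (a : A * bool) : A * bool := (a.1, ~~ a.2).

Definition no_backtrack (p : seq (A * bool)) : bool :=
  sorted (fun a b => b != sinv a) p.

Lemma sinvK : involutive sinv.
Proof. by case=> a b; rewrite /sinv negbK. Qed.

Definition push (a : A * bool) (w : seq (A * bool)) : seq (A * bool) :=
  if w is b :: w' then if b == sinv a then w' else a :: w else [:: a].

Definition reduce (w : seq (A * bool)) : seq (A * bool) := foldr push [::] w.

Lemma reduced_behead a w : no_backtrack (a :: w) -> no_backtrack w.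
Proof. by case: w => //= b w /andP[]. Qed.

Lemma reduced_push a w : no_backtrack w -> no_backtrack (push a w).
Proof.
case: w => //= b w rw; case: ifPn => [_|nb] /=; last by rewrite nb.
exact: reduced_behead rw.
Qed.

Lemma reduce_reduced w : no_backtrack (reduce w).
Proof. by elim: w => //= a w; apply: reduced_push. Qed.

Lemma reduceK w : no_backtrack w -> reduce w = w.
Proof.
elim: w => //= a w IH raw; rewrite IH ?(reduced_behead raw) //.
by case: w raw {IH} => //= b w /andP[/negPf->].
Qed.

Lemma pushK a w : no_backtrack w -> push a (push (sinv a) w) = w.
Proof.
case: w => [_|b w rw] /=; first by rewrite eqxx.
rewrite sinvK; case: eqP => [eba|_] /=; last by rewrite eqxx.
move: rw; rewrite eba; case: w => //= c w /andP[/negPf-> _] //.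
Qed.

Lemma reduce_catr u v : reduce (u ++ reduce v) = reduce (u ++ v).
Proof. by rewrite /reduce !foldr_cat -!/(reduce _) reduceK ?reduce_reduced. Qed.

Lemma reduce_catl u v : reduce (reduce u ++ v) = reduce (u ++ v).
Proof.
elim: u => //= a u <-; case: (reduce u) => //= b w; case: eqP => //= ->.
by rewrite pushK ?reduce_reduced.
Qed.

Definition winv (w : seq (A * bool)) : seq (A * bool) := rev (map sinv w).

Lemma reduce_winvl w : reduce (winv w ++ w) = [::].
Proof.
elim: w => //= a w IH; rewrite /winv /= rev_cons -cats1 -catA /=.
have red_aa : reduce [:: sinv a, a & w] = reduce w.
  by rewrite /= -{2}[a]sinvK pushK ?reduce_reduced.
by rewrite -reduce_catr red_aa reduce_catr.
Qed.

End Signed.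

Section FreeGroup.
Variable X : choiceType.

Definition freeGroup : Type := {w : seq (X * bool) | no_backtrack w}.

HB.instance Definition _ := Choice.on freeGroup.

Definition of_word (w : seq (X * bool)) : freeGroup :=
  exist _ (reduce w) (reduce_reduced w).

Definition fg_one : freeGroup := of_word [::].
Definition fg_mul (u v : freeGroup) : freeGroup := of_word (val u ++ val v).
Definition fg_inv (u : freeGroup) : freeGroup := of_word (winv (val u)).

Lemma fg_mulA : associative fg_mul.
Proof.
by move=> u v w; apply/val_inj; rewrite /= reduce_catr reduce_catl catA.
Qed.

Lemma fg_mul1 : left_id fg_one fg_mul.
Proof. by move=> u; apply/val_inj; rewrite /= reduceK ?(valP u). Qed.

Lemma fg_mulr1 : right_id fg_one fg_mul.
Proof. by move=> u; apply/val_inj; rewrite /= cats0 reduceK ?(valP u). Qed.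

Lemma fg_mulV : left_inverse fg_one fg_inv fg_mul.
Proof. by move=> u; apply/val_inj; rewrite /= reduce_catl reduce_winvl. Qed.

Lemma fg_mulrV : right_inverse fg_one fg_inv fg_mul.
Proof.
move=> u; apply/val_inj; rewrite /= reduce_catr.
have {1}-> : val u = winv (winv (val u)).
  by rewrite /winv map_rev revK -map_comp map_id_in // => a _ /=; rewrite sinvK.
by rewrite reduce_winvl.
Qed.

HB.instance Definition _ :=
  isGroup.Build freeGroup fg_mulA fg_mul1 fg_mulr1 fg_mulV fg_mulrV.

Definition letter (a : X * bool) : freeGroup := of_word [:: a].

End FreeGroup.

(* Only finite digraphs are needed: a Stallings graph of a finitely generated
   subgroup is finite. *)
Record xdigraph (X : choiceType) := XDigraph {
  vert : finType;
  edge : finType;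
  orig : edge -> vert;
  term : edge -> vert;
  lab : edge -> X
}.

Section Digraphs.
Variables (X : choiceType) (Gam : xdigraph X).
Implicit Types (u v : vert Gam) (a : edge Gam * bool).

Definition src a : vert Gam := if a.2 then orig a.1 else term a.1.
Definition tgt a : vert Gam := if a.2 then term a.1 else orig a.1.

Fixpoint is_path u (p : seq (edge Gam * bool)) v : bool :=
  if p is a :: p' then (src a == u) && is_path (tgt a) p' v else u == v.

Definition path_label (p : seq (edge Gam * bool)) : freeGroup X :=
  \prod_(a <- p) letter (lab a.1, a.2).

Definition dist u v : option nat :=
  min_ext (fun n => exists p, is_path u p v /\ size p = n).

(* Pairs at infinite distance are left out; the empty maximum is 0. *)
Definition diam : nat :=
  \max_(uv : vert Gam * vert Gam | dist uv.1 uv.2 != None)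
     odflt 0 (dist uv.1 uv.2).

Definition connected_graph : Prop := forall u v, exists p, is_path u p v.

Definition folded : Prop :=
  (forall e e' : edge Gam, orig e = orig e' -> lab e = lab e' -> e = e') /\
  (forall e e' : edge Gam, term e = term e' -> lab e = lab e' -> e = e').

(* A loop contributes 2. *)
Definition degree v : nat :=
  #|[set e : edge Gam | orig e == v]%SET| +
  #|[set e : edge Gam | term e == v]%SET|.

(* For Gam = Gamma(H) this is H^v. *)
Definition cycle_labels v : set (freeGroup X) :=
  [set w | exists p, [/\ is_path v p v, no_backtrack p & path_label p = w]].

(* Finiteness, built into [xdigraph], cannot be dropped here: attaching an
   infinite ray at the marked vertex of a finite solution would preserve all
   the conditions below. *)
Definition is_stallings_graph (b : vert Gam) (H : set (freeGroup X)) : Prop :=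
  [/\ connected_graph, folded, H = cycle_labels b
    & forall v, v != b -> 2 <= degree v].

Definition Omega : set (set (freeGroup X)) :=
  [set K | exists u v, u != v /\ K = cycle_labels u `&` cycle_labels v].

Definition rel_length (w : freeGroup X) : option nat :=
  min_ext (fun k => exists s : seq (freeGroup X),
    [/\ size s = k, \prod_(x <- s) x = w
      & forall x, x \in s ->
          (exists l : X * bool, x = letter l) \/ (exists2 K, Omega K & K x)]).

Definition gamma (N : set (freeGroup X)) : option nat :=
  min_ext (fun k => exists w, [/\ N w, w <> 1 & rel_length w = Some k]).

Definition induced_edge (P : pred (vert Gam)) : finType :=
  {e : edge Gam | P (orig e) && P (term e)}.

Definition induced (P : pred (vert Gam)) : xdigraph X :=
  @XDigraph X {v : vert Gam | P v} (induced_edge P)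
    (fun e => exist _ (orig (val e)) (proj1 (andP (valP e))))
    (fun e => exist _ (term (val e)) (proj2 (andP (valP e))))
    (fun e => lab (val e)).

End Digraphs.

Definition product_graph (X : choiceType) (G1 G2 : xdigraph X) : xdigraph X :=
  @XDigraph X (vert G1 * vert G2)%type
    {e : edge G1 * edge G2 | lab e.1 == lab e.2}
    (fun e => (orig (val e).1, orig (val e).2))
    (fun e => (term (val e).1, term (val e).2))
    (fun e => lab (val e).1).

(* When Gam is connected and folded, the vertices (v, v) form a connected
   component of the product, and removing it amounts to keeping the subgraph
   induced on the other vertices. *)
Definition offdiag_product (X : choiceType) (Gam : xdigraph X) : xdigraph X :=
  @induced X (product_graph Gam Gam) (fun uv => uv.1 != uv.2).

(* Main.v *)
(* If [w] in H lies in <<N>>_F but not in N, a product of conjugates of elements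
   of N equal to w gives a planar map on the sphere each of whose faces has trivial
   label in F or lifts to a closed path of Gamma(H), with label in the conjugate
   of N at its base point for all faces but one.
   Take such a map with the fewest darts in the component of the bad face. No face
   has trivial label, otherwise one folds it; and no edge has the same lift on its
   two sides, otherwise one deletes it, which either merges two faces or splits the
   component in two, one half being a smaller counterexample. Hence every edge lifts
   to the off-diagonal product, and a run of edges through vertices of degree 2 has
   H-length at most C, being a geodesic of that product followed by an element
   of some H^u /\ H^v. As gamma_H(N) >= 6C + 2 diam, the base point costing at most
   2 diam, every face but the bad one has at least 6 corners of degree at least 3,
   and Euler's formula is violated: on the sphere, the sum over the faces of
   6 minus the number of such corners is at least 12.

   The set of darts [D] and the edge involution [eps] never change: all surgeries
   multiply the face permutation [phi] by a transposition. This preserves planarity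
   as soon as the two darts lie on the same face, or at the same vertex, or in
   different components. *)

Require Import Defs.
From mathcomp Require Import all_boot fingroup perm zify.
From mathcomp Require Import boolp classical_sets.

Set Implicit Arguments.
Unset Strict Implicit.
Unset Printing Implicit Defensive.

Local Open Scope classical_set_scope.
Local Open Scope nat_scope.

(** * Euler's formula for combinatorial maps *)

Section PermOrbits.
Variable D : finType.
Implicit Types (e : rel D) (s phi : {perm D}).

Definition orbn s := #|porbits s|.

(** Products compose from left to right: the darts that [phi] sends to [x] and [y] exchange their
    images. A cycle through both is cut just before [x] and just before [y]; two distinct cycles are
    joined. *)
Definition twist phi x y : {perm D} := (phi * tperm x y)%g.

Lemma twistE phi x y z : twist phi x y z = tperm x y (phi z).
Proof. exact: permM. Qed.

Lemma twistK phi x y : twist (twist phi x y) x y = phi.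
Proof. by rewrite /twist -mulgA tperm2 mulg1. Qed.

Lemma orbn_twist s x y :
  orbn (twist s x y) + (x \notin porbit s y).*2 = orbn s + (x != y).
Proof.
have /= := porbits_mul_tperm s^-1%g x y.
by rewrite porbitsV porbitV /orbn -[porbits (twist _ _ _)]porbitsV invMg tpermV.
Qed.

Lemma fconnect_porbit s x y : fconnect s x y = (y \in porbit s x).
Proof.
apply/idP/porbitP => [/iter_findex <-|[i ->]]; last by rewrite permX fconnect_iter.
by exists (findex s x y); rewrite permX.
Qed.

Lemma orbn_fcard s : orbn s = fcard s D.
Proof.
have sym_s : connect_sym (frel s) := fconnect_sym (@perm_inj _ s).
rewrite /orbn /n_comp_mem.
rewrite -(@card_in_imset _ _ (porbit s) (predI (froots s) D)); last first.
  move=> x y /andP[/eqP rx _] /andP[/eqP ry _] /eqP.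
  by rewrite eq_porbit_mem porbit_sym -fconnect_porbit -root_connect ?rx ?ry // => /eqP.
apply: eq_card => A; apply/imsetP/imsetP => -[x _ ->]; last by exists x.
exists (froot s x); first by rewrite !inE roots_root.
by apply/eqP; rewrite eq_porbit_mem porbit_sym -fconnect_porbit connect_root.
Qed.

Lemma orbn1 : orbn 1%g = #|D|.
Proof.
rewrite /orbn /porbits card_imset // => x y /eqP.
by rewrite eq_porbit_mem => /porbitP[i ->]; rewrite expg1n perm1.
Qed.

Definition pair_rel (x y : D) : rel D :=
  fun u v => (u == x) && (v == y) || (u == y) && (v == x).
Arguments pair_rel x y u v /.

Lemma pair_rel_sym x y : symmetric (pair_rel x y).
Proof. by move=> u v; rewrite /= orbC ![(v == _) && _]andbC. Qed.

(** The union [a] of the classes of [x] and [y] is closed for both relations. Outside [a] the added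
    pair changes nothing; inside, [e] has one or two classes and the enlarged relation only one. *)
Lemma n_comp_add_pair e x y : connect_sym e ->
  n_comp e D = n_comp (relU e (pair_rel x y)) D + ~~ connect e x y.
Proof.
move=> sym_e; set e' := relU _ _.
have sym_e' : connect_sym e'.
  by apply: relU_sym => //; apply/sym_connect_sym/pair_rel_sym.
have sub_ee' : subrel (connect e) (connect e').
  by apply: connect_sub => u v euv; apply: connect1; rewrite /= euv.
have e'xy : connect e' x y by apply: connect1; rewrite /= !eqxx orbT.
pose a := closure e (pred2 x y).
have clP u : (u \in a) = connect e x u || connect e y u.
  rewrite ![connect e _ u]sym_e; apply/idP/idP => [|/orP[] euv].
  - by case/pred0Pn => z /= /andP[]; rewrite !inE => euz /orP[]/eqP<-; rewrite euz ?orbT.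
  - by apply/pred0Pn; exists x; rewrite /= !inE eqxx euv.
  - by apply/pred0Pn; exists y; rewrite /= !inE eqxx orbT euv.
have cl_a : closed e a by apply: closure_closed.
have cl_a' : closed e' a.
  apply: intro_closed => // u v /= /orP[/cl_a -> //|].
  by case/orP => /andP[/eqP-> /eqP->] _; rewrite clP connect0 ?orbT.
have ea : n_comp e a = (~~ connect e x y).+1 by apply: n_comp_closure2.
have ea' : n_comp e' a = 1.
  rewrite -(n_comp_connect sym_e' x); apply: eq_n_comp_r => u.
  rewrite clP; apply/idP/idP => [/orP[/sub_ee'//|/sub_ee']|].
    exact: connect_trans.
  move=> e'xu; have := closed_connect cl_a' e'xu.
  by rewrite !clP connect0 => <-.
have eC : n_comp e [predC a] = n_comp e' [predC a].
  apply: eq_card => u; rewrite !inE /=; case au: (u \in a); rewrite ?andbF //= !andbT.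
  suff ee u' : connect e u u' = connect e' u u'.
    by rewrite /roots /root (eq_pick ee).
  apply/idP/idP => [/sub_ee'//|/connectP[p]].
  elim: p u au => [|v p IH] u au /=; first by move=> _ ->.
  move=> /andP[/orP[euv|]].
    move=> e'p lastp; apply: (connect_trans (connect1 euv)); apply: IH => //.
    by rewrite -(cl_a _ _ euv).
  have uNx z : z \in pred2 x y -> u <> z.
    by rewrite !inE => xyz uz; move: au; rewrite clP uz; case/orP: xyz => /eqP->; rewrite connect0 ?orbT.
  by case/orP => /andP[/eqP ux _] _; case: (uNx _ _ ux); rewrite !inE eqxx ?orbT.
by rewrite (n_compC a e) (n_compC a e') ea ea' eC; lia.
Qed.

End PermOrbits.
Arguments pair_rel {D} x y u v /.

Section Maps.
Variables (D : finType) (eps : {perm D}).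
Implicit Types phi : {perm D}.

Definition glink phi : rel D := fun x y => (phi x == y) || (eps x == y).
Arguments glink phi x y /.
Definition conn phi := connect (glink phi).
Definition ncomp phi := n_comp (glink phi) D.
Definition vperm phi : {perm D} := (eps * phi)%g.

(* [phi], [eps] and [vperm phi] are the face, edge and vertex permutations of a
   combinatorial map with darts [D]; this is Euler's formula V + F = E + 2c. *)
Definition planar phi :=
  orbn phi + orbn (vperm phi) + orbn eps = #|D| + (ncomp phi).*2.

Lemma vperm_twist phi x y : vperm (twist phi x y) = twist (vperm phi) x y.
Proof. exact: mulgA. Qed.

Lemma conn_sym phi : connect_sym (glink phi).
Proof.
apply: (@relU_sym _ (frel phi) (frel eps)); exact: fconnect_sym (@perm_inj _ _).
Qed.

Lemma conn_phi phi x : conn phi x (phi x).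
Proof. by apply: connect1; rewrite /= eqxx. Qed.

Lemma conn_eps phi x : conn phi x (eps x).
Proof. by apply: connect1; rewrite /= eqxx orbT. Qed.

Lemma conn_porbit phi x y : y \in porbit phi x -> conn phi x y.
Proof.
rewrite -fconnect_porbit; apply: connect_sub => u v /eqP <-; exact: conn_phi.
Qed.

Lemma conn_vorbit phi x y : y \in porbit (vperm phi) x -> conn phi x y.
Proof.
rewrite -fconnect_porbit; apply: connect_sub => u v /eqP <-; rewrite permM.
exact: connect_trans (conn_eps _ _) (conn_phi _ _).
Qed.

Lemma conn_sub phi phi' :
  (forall x, conn phi x (phi' x)) -> subrel (conn phi') (conn phi).
Proof.
move=> H; apply: connect_sub => u v /orP[]/eqP<-; [exact: H|exact: conn_eps].
Qed.

(** Once [x] and [y] are linked, [phi] and its twist have the same components, so both sides follow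
    from [n_comp_add_pair]. *)
Lemma ncomp_twist phi x y : let phi' := twist phi x y in
  ncomp phi' + ~~ conn phi x y = ncomp phi + ~~ conn phi' x y.
Proof.
move=> phi'; rewrite /ncomp.
rewrite (n_comp_add_pair x y (conn_sym phi)) (n_comp_add_pair x y (conn_sym phi')).
rewrite -/(conn _ _ _) -/(conn _ _ _) addnAC; congr (_ + _ + _).
have sub u psi : psi = twist u x y ->
    subrel (glink psi) (connect (relU (glink u) (pair_rel x y))).
  move=> -> s t /orP[]/eqP <-; last first.
    by apply: connect1; rewrite /= eqxx orbT.
  rewrite twistE; have cu : connect (relU (glink u) (pair_rel x y)) s (u s).
    by apply: connect1; rewrite /= eqxx.
  apply: (connect_trans cu); case: tpermP => [->|->|_ _]; last exact: connect0.
    by apply: connect1; rewrite /= !eqxx !orbT.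
  by apply: connect1; rewrite /= !eqxx !orbT.
have Eq : connect (relU (glink phi') (pair_rel x y))
    =2 connect (relU (glink phi) (pair_rel x y)).
  move=> s t; apply/idP/idP; apply: connect_sub => u v /= /orP[guv|puv].
  - exact: (sub phi phi').
  - by apply: connect1; rewrite /= puv orbT.
  - by apply: (sub phi' phi); rewrite // twistK.
  - by apply: connect1; rewrite /= puv orbT.
by rewrite (eq_n_comp Eq).
Qed.

(** This is the non-negativity of the genus, by induction on the number of darts moved by [phi]. For
    the identity, vertices and components are both the edges, and equality holds. *)
Lemma euler_inequality phi :
  orbn phi + orbn (vperm phi) + orbn eps <= #|D| + (ncomp phi).*2.
Proof.
set dD := #|D|.
have [n] := ubnP #|[pred x | phi x != x]|; elim: n phi => // n IH phi lt_n.
have [x phix|phi1] := pickP [pred x | phi x != x]; last first.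
  have -> : phi = 1%g by apply/permP => x; rewrite perm1; have /negbFE/eqP := phi1 x.
  rewrite orbn1 -/dD.
  suff -> : ncomp 1%g = orbn eps by rewrite /vperm mulg1; lia.
  rewrite orbn_fcard /ncomp; apply: eq_n_comp => u v; apply/idP/idP;
    apply: connect_sub => {u v} u v /=.
    by rewrite perm1 => /orP[/eqP->//|/eqP <-]; apply: connect1; rewrite /= eqxx.
  by move=> /eqP <-; apply: connect1; rewrite /= eqxx orbT.
(* The twist makes [x] a fixed point, which adds one face. The number of vertices moves by one, and
   a new component appears only if it rises. *)
move: phix => /= phix; pose phi' := twist phi (phi x) x.
have xo : phi x \in porbit phi x by rewrite (mem_porbit phi 1).
have F := orbn_twist phi (phi x) x.
have V := orbn_twist (vperm phi') (phi x) x.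
have c := ncomp_twist phi (phi x) x.
have cx : conn phi (phi x) x by rewrite /conn conn_sym; exact: conn_porbit.
have {IH}/IH IH : #|[pred x | phi' x != x]| < n.
  rewrite -ltnS; apply: leq_trans lt_n; rewrite ltnS.
  apply: proper_card; apply/properP; split; last first.
    by exists x; rewrite !inE // twistE tpermL eqxx.
  apply/fintype.subsetP => y; rewrite !inE twistE; apply: contra => /eqP phiy.
  rewrite phiy tpermD //; last by apply/eqP => xy; rewrite xy phiy eqxx in phix.
  by apply/eqP => pxy; case/eqP: phix; rewrite pxy; apply: (@perm_inj _ phi); rewrite phiy pxy.
move: V F c; rewrite -vperm_twist twistK -/phi' xo cx phix /=.
have : (phi x \notin porbit (vperm phi') x) || conn phi' (phi x) x.
  case: (boolP (_ \in _)) => //= /conn_vorbit cc; rewrite /conn conn_sym; exact: cc.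
by case: (phi x \in _); case: (conn phi' _ _) => //= _; lia.
Qed.

(** One of the numbers of faces and vertices rises by one. If the other falls, [x] and [y] end on a
    common orbit and the components do not change; if it rises too, [euler_inequality] forces a new
    component. *)
Lemma planar_split phi x y : planar phi -> x != y ->
    (x \in porbit phi y) || (x \in porbit (vperm phi) y) ->
  planar (twist phi x y).
Proof.
move=> pl xy same; set phi' := twist _ _ _.
have cxy : conn phi x y.
  rewrite /conn conn_sym; case/orP: same; [exact: conn_porbit|exact: conn_vorbit].
have F := orbn_twist phi x y; have V := orbn_twist (vperm phi) x y.
have c := ncomp_twist phi x y; have le := euler_inequality phi'.
have cF : x \in porbit phi' y -> conn phi' x y.
  by move=> /conn_porbit cyx; rewrite /conn conn_sym; exact: cyx.
have cV : x \in porbit (vperm phi') y -> conn phi' x y.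
  by move=> /conn_vorbit cyx; rewrite /conn conn_sym; exact: cyx.
have F' := orbn_twist phi' x y; have V' := orbn_twist (vperm phi') x y.
move: F' V'; rewrite -vperm_twist twistK.
move: same F V c cF cV le pl; rewrite /planar -vperm_twist -/phi' cxy xy.
case: (x \in porbit phi y); case: (x \in porbit (vperm phi) y) => //= _;
case: (x \in porbit phi' y); case: (x \in porbit (vperm phi') y);
case: (conn phi' x y) => //= F V c cF cV;
  do ?[by have := cF isT]; do ?[by have := cV isT]; lia.
Qed.

(** Faces and vertices both gain one, so Euler's formula for the two maps forces a new component,
    which can only separate [x] from [y]. *)
Lemma planar_pinch phi x y : planar phi -> x != y ->
    x \in porbit phi y -> x \in porbit (vperm phi) y ->
  ~~ conn (twist phi x y) x y.
Proof.
move=> pl xy oF oV.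
have pl' : planar (twist phi x y) by apply: planar_split; rewrite ?oF.
have cxy : conn phi x y by rewrite /conn conn_sym; exact: conn_porbit.
have F := orbn_twist phi x y; have V := orbn_twist (vperm phi) x y.
have := ncomp_twist phi x y; move: F V pl pl'.
rewrite /planar vperm_twist oF oV xy cxy /=; case: (conn _ _ _) => //=; lia.
Qed.

(** Faces, vertices and components all lose one. *)
Lemma planar_join phi x y : planar phi -> ~~ conn phi x y ->
  planar (twist phi x y).
Proof.
move=> pl cxy; set phi' := twist _ _ _.
have xy : x != y by apply: contraNneq cxy => ->; exact: connect0.
have F := orbn_twist phi x y; have V := orbn_twist (vperm phi) x y.
have c := ncomp_twist phi x y; have le := euler_inequality phi'.
have oF : x \notin porbit phi y.
  by apply: contra cxy => /conn_porbit cyx; rewrite /conn conn_sym; exact: cyx.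
have oV : x \notin porbit (vperm phi) y.
  by apply: contra cxy => /conn_vorbit cyx; rewrite /conn conn_sym; exact: cyx.
have F' := orbn_twist phi' x y; rewrite twistK in F'.
have cF : x \in porbit phi' y -> conn phi' x y.
  by move=> /conn_porbit cyx; rewrite /conn conn_sym; exact: cyx.
move: F V c le pl cF F'; rewrite -vperm_twist oF oV xy cxy -/phi' /planar.
case: (x \in _); case: (conn phi' _ _) => //= F V c le pl cF;
  do ?[by have := cF isT]; lia.
Qed.

End Maps.
Arguments glink {D} eps phi x y /.
(** * Surgery on faces *)

Section Faces.
Variables (D : finType) (eps : {perm D}).
Implicit Types (phi : {perm D}) (s a b : seq D).

(* A facial walk, up to rotation; the empty sequence is allowed. *)
Definition face phi s := uniq s && fcycle phi s.

Lemma face_rot phi a b : face phi (a ++ b) = face phi (b ++ a).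
Proof.
by rewrite /face -[b ++ a](rot_size_cat a b) rot_uniq rot_cycle.
Qed.

Lemma face_porbit phi s x y : face phi s -> x \in s -> y \in s -> x \in porbit phi y.
Proof.
by move=> /andP[_ cs] xs ys; rewrite -fconnect_porbit (fconnect_cycle cs ys).
Qed.

Lemma face_next phi s x : face phi s -> (phi x \in s) = (x \in s).
Proof.
move=> fs; apply/idP/idP => xs; case/andP: (fs) => _ cs.
  rewrite -(fconnect_cycle cs xs) (fconnect_sym (@perm_inj _ phi)).
  exact: fconnect1.
by rewrite -(fconnect_cycle cs xs) fconnect1.
Qed.

Lemma face_eq phi phi' s : {in s, phi' =1 phi} -> face phi s -> face phi' s.
Proof.
move=> eqs /andP[us cs]; rewrite /face us /=.
rewrite (@eq_in_cycle _ [in s] _ (frel phi)) //.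
by move=> x y /eqs /= ->.
Qed.

Lemma face_cons phi x p : face phi (x :: p) =
  [&& uniq (x :: p), path (frel phi) x p & phi (last x p) == x].
Proof. by rewrite /face /= rcons_path. Qed.

Lemma face_exists phi x : exists s, face phi (x :: s).
Proof.
have := orbit_uniq phi x; have := cycle_orbit (@perm_inj _ phi) x.
rewrite /orbit -orderSpred /= => cs us; exists (traject phi (phi x) (fingraph.order phi x).-1).
by rewrite /face /= us.
Qed.

Lemma face_mem phi s t x : face phi s -> face phi t -> x \in s -> x \in t -> s =i t.
Proof.
move=> /andP[_ cs] /andP[_ ct] xs xt y.
by rewrite -(fconnect_cycle cs xs) -(fconnect_cycle ct xt).
Qed.

Lemma face_conn phi s x y : face phi s -> x \in s -> y \in s -> conn eps phi x y.
Proof. by move=> fs xs ys; apply: conn_porbit; exact: face_porbit fs ys xs. Qed.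

Lemma face_head phi x s t :
  face phi (x :: s) -> face phi (x :: t) -> s = t.
Proof.
move=> fs ft; have Es := face_mem fs ft (mem_head _ _) (mem_head _ _).
move: (fs) (ft); rewrite !face_cons => /and3P[us ps _] /and3P[ut pt _].
have /eqP sz : size (x :: s) == size (x :: t) by rewrite (perm_size (uniq_perm us ut Es)).
have [m Em] := fpathP ps; have [n En] := fpathP pt.
by move: sz; rewrite Em En /= !size_traject => -[->].
Qed.

Lemma path_twist phi u w x p : u \notin p -> w \notin p ->
  path (frel phi) x p -> path (frel (twist phi u w)) x p.
Proof.
elim: p x => //= y p IH x; rewrite !inE !negb_or => /andP[uy up] /andP[wy wp].
by case/andP => /eqP xy /(IH _ up wp) ->; rewrite twistE xy tpermD // eqxx.
Qed.

Lemma twist_out phi u w s z : face phi s -> u \in s -> w \in s -> z \notin s ->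
  twist phi u w z = phi z.
Proof.
move=> fs us ws zs; rewrite twistE tpermD //; apply: contraNneq zs => E.
  by rewrite -(face_next _ fs) -E.
by rewrite -(face_next _ fs) -E.
Qed.

Lemma face_split phi u w a b : face phi (u :: a ++ w :: b) ->
  let phi' := twist phi u w in
  [/\ face phi' (u :: a), face phi' (w :: b)
    & forall z, z \notin u :: a ++ w :: b -> phi' z = phi z].
Proof.
move=> fs phi'; have us : u \in u :: a ++ w :: b by rewrite inE eqxx.
have ws : w \in u :: a ++ w :: b by rewrite !(inE, mem_cat) eqxx !orbT.
split; last by move=> z; exact: twist_out fs us ws.
all: move: fs; rewrite !face_cons -cat_cons cat_uniq has_sym last_cat cat_path.
all: case/and3P => /and3P[ua] /= /norP[]; rewrite inE negb_or => /andP[uw ub] hb wb.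
all: case/and3P => pa /eqP eu pb /eqP ew.
all: move: ua wb => /= /andP[ua ua'] /andP[wb wb'].
  rewrite ua ua' path_twist //= ?twistE ?eu ?tpermR //.
  by apply: contra hb => wa; apply/hasP; exists w; rewrite ?mem_head.
by rewrite /= wb wb' path_twist //= twistE ew tpermL.
Qed.

Lemma face_join phi u w a b : face phi (u :: a) -> face phi (w :: b) ->
    w \notin u :: a ->
  let phi' := twist phi u w in face phi' (u :: a ++ w :: b) /\
    forall z, z \notin u :: a ++ w :: b -> phi' z = phi z.
Proof.
move=> fa fb wa phi'.
have dis z : z \in u :: a -> z \notin w :: b.
  move=> za; apply: contra wa => zb.
  by rewrite (face_mem fa fb za zb) inE eqxx.
split=> [|z]; last first.
  rewrite -cat_cons mem_cat negb_or => /andP[za zb]; rewrite twistE tpermD //.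
    by apply: contraNneq za => E; rewrite -(face_next _ fa) -E inE eqxx.
  by apply: contraNneq zb => E; rewrite -(face_next _ fb) -E inE eqxx.
rewrite face_cons -cat_cons cat_uniq last_cat cat_path.
move: fa fb; rewrite !face_cons => /and3P[ua pa /eqP eu] /and3P[ub pb /eqP ew].
rewrite ua ub /= !twistE eu ew tpermL tpermR !eqxx !andbT /=.
have ub' := dis u (mem_head _ _); move: ua ub ub' wa; rewrite /= !inE !negb_or.
move=> /andP[ua _] /andP[wb _] /andP[uw ub'] /andP[wu wa].
rewrite !path_twist //= !andbT; rewrite wu wa /=.
by apply/hasPn => z zb; apply: contraL zb => /dis; rewrite inE negb_or => /andP[].
Qed.

Lemma conn_twist phi u w : conn eps phi u w ->
  subrel (conn eps (twist phi u w)) (conn eps phi).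
Proof.
move=> uw; apply: conn_sub => x; have := conn_phi eps phi x.
rewrite twistE; case: tpermP => // -> xu; first exact: connect_trans xu uw.
by apply: connect_trans xu _; rewrite conn_sym.
Qed.

End Faces.

Section Surgery.
Variables (D : finType) (eps : {perm D}).
Hypotheses (epsK : involutive eps) (eps_neq : forall x, eps x != x).
Implicit Types (phi : {perm D}) (s a b : seq D).

(** After the twist [x] is followed by [eps x]: its edge has been detached from the other darts at
    the terminus of [x]. Both [phi x] and [eps x] start at that vertex, so this is a cut at one
    vertex. *)
Lemma planar_trim phi x : planar eps phi -> phi x != eps x ->
  planar eps (twist phi (phi x) (eps x)).
Proof.
move=> pl ne; apply: planar_split => //; apply/orP; right.
have -> : phi x = vperm eps phi (eps x) by rewrite permM epsK.
exact: (mem_porbit _ 1).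
Qed.

Lemma conn_trim phi x : conn eps phi (phi x) (eps x).
Proof.
by apply: connect_trans (conn_eps _ _ _); rewrite conn_sym; exact: conn_phi.
Qed.

(** Detaching the edge at the terminus of [x] merges the two faces into [x, eps x, b, a]; a second
    cut, along this face, frees its other end. The edge becomes a component of its own, with the
    single face [x, eps x]. *)
Lemma delete_edge phi x a b : planar eps phi ->
    face phi (x :: a) -> face phi (eps x :: b) -> eps x \notin x :: a ->
  exists phi', [/\ planar eps phi', face phi' (b ++ a),
    phi' x = eps x /\ phi' (eps x) = x,
    forall z, z \notin x :: a -> z \notin eps x :: b -> phi' z = phi z
    & subrel (conn eps phi') (conn eps phi)].
Proof.
move=> pl fa fb xa.
(* [u] is the successor of [x], which is [x] itself when [a] is empty. *)
have [u [c Ea]] : exists u c, rcons a x = u :: c by case: a {fa xa}; do 2!eexists.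
have fc : face phi (u :: c) by rewrite -Ea -cats1 face_rot.
have Eu : phi x = u.
  by move: fc; rewrite face_cons => /and3P[_ _ /eqP]; rewrite -(last_cons x u c) -Ea last_rcons.
have xc : eps x \notin u :: c by rewrite -Ea mem_rcons.
have [] := face_join fc fb xc; rewrite -cat_cons -Ea.
set phi1 := twist phi u (eps x) => f1 out1.
have pl1 : planar eps phi1.
  rewrite /phi1 -Eu; apply: planar_trim => //.
  by apply: contraNneq xc => <-; rewrite Eu mem_head.
have c1 : subrel (conn eps phi1) (conn eps phi).
  by apply: conn_twist; rewrite -Eu conn_trim.
move: f1 out1; rewrite -cats1 -catA => f1 out1; rewrite face_rot /= in f1.
have outP z : z \notin x :: a -> z \notin eps x :: b -> phi1 z = phi z.
  move=> za zb; apply: out1; move: za zb; rewrite !(inE, mem_cat) !negb_or.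
  by case/andP => -> -> /andP[-> ->].
move: f1; rewrite (face_rot phi1 [:: x; eps x] (b ++ a)); case E: (b ++ a) => [|v d] f1.
  exists phi1; split=> //; move: f1; rewrite face_cons /= => /and3P[_].
  by rewrite andbT => /eqP-> /eqP->.
have vx : v != x.
  by apply: contraTneq f1 => ->; rewrite face_cons /= mem_cat mem_head orbT.
have [fv fx out] := face_split f1; set phi2 := twist phi1 v x in fv fx out.
have sv : v \in v :: d ++ x :: [:: eps x] by rewrite mem_head.
have sx : x \in v :: d ++ x :: [:: eps x] by rewrite inE mem_cat mem_head !orbT.
exists phi2; split=> //.
- by apply: planar_split => //; rewrite (face_porbit f1).
- by move: fx; rewrite face_cons /= => /and3P[_]; rewrite andbT => /eqP-> /eqP->.
- move=> z za zb; rewrite out ?outP //.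
  rewrite -cat_cons -E !(mem_cat, inE) !negb_or.
  by move: za zb; rewrite !inE !negb_or => /andP[-> ->] /andP[-> ->].
by move=> y z /(conn_twist (face_conn eps f1 sv sx)); apply: c1.
Qed.

(** [w] follows [eps x], so [x] and [w] start at the same vertex and lie on the same face:
    [planar_pinch] applies. Both darts of the edge stay with [a]. *)
Lemma pinch_edge phi x w a b : planar eps phi ->
    face phi (x :: a ++ eps x :: w :: b) ->
  exists phi', [/\ planar eps phi', face phi' (x :: a ++ [:: eps x]),
    face phi' (w :: b), ~~ conn eps phi' x w
    & (forall z, z \notin x :: a ++ eps x :: w :: b -> phi' z = phi z) /\
      subrel (conn eps phi') (conn eps phi)].
Proof.
move=> pl; rewrite -cat_rcons -cats1 => fs; have [fx fw out] := face_split fs.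
have sx : x \in x :: (a ++ [:: eps x]) ++ w :: b by rewrite mem_head.
have sw : w \in x :: (a ++ [:: eps x]) ++ w :: b by rewrite inE mem_cat mem_head !orbT.
have xw : x != w.
  by apply: contraTneq fs => ->; rewrite face_cons /= mem_cat mem_head orbT.
have Ew : phi (eps x) = w.
  move: fs; rewrite face_cons cat_path => /and3P[_ /andP[_ /= /andP[/eqP <- _]] _].
  by rewrite cats1 last_rcons.
have ox : x \in porbit phi w by exact: face_porbit fs sx sw.
have ov : x \in porbit (vperm eps phi) w.
  by rewrite porbit_sym -Ew -[phi _]permM; exact: (mem_porbit _ 1).
exists (twist phi x w); split=> //.
- by apply: planar_split; rewrite ?ox.
- exact: planar_pinch.
by split=> //; apply: conn_twist; exact: face_conn fs sx sw.
Qed.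

(** The edges of [A] are detached with [planar_trim], one dart at a time, until each is a component
    of its own. *)
Lemma isolate phi (A : pred D) : planar eps phi ->
    (forall x, A (phi x) = A x) -> (forall x, A (eps x) = A x) ->
  exists phi', [/\ planar eps phi', forall x, ~~ A x -> phi' x = phi x
    & forall x, A x -> phi' x = eps x].
Proof.
move=> + + Ae; have [n] := ubnP #|[pred x | A x && (phi x != eps x)]|.
elim: n phi => // n IH phi lt_n pl Ap.
have [x /andP[Ax px]|all_iso] := pickP [pred x | A x && (phi x != eps x)]; last first.
  exists phi; split=> // x Ax.
  by have := all_iso x; rewrite /= Ax => /negbFE/eqP.
pose phi1 := twist phi (phi x) (eps x).
have Ap1 z : A (phi1 z) = A z.
  by rewrite twistE; case: tpermP => [zx|zx|_ _]; rewrite -[RHS]Ap ?zx ?Ap ?Ae.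
have [|||phi2 [pl2 out2 in2]] := IH phi1; [|exact: planar_trim|exact: Ap1|].
  rewrite -ltnS; apply: leq_trans lt_n; rewrite ltnS.
  apply: proper_card; apply/properP; split; last first.
    by exists x; rewrite !inE ?Ax // twistE tpermL eqxx.
  apply/fintype.subsetP => y; rewrite !inE => /andP[Ay]; rewrite Ay /=.
  apply: contra => /eqP Ey; rewrite twistE Ey tpermD //; last first.
    by apply: contraNneq px => /perm_inj ->; rewrite Ey.
  by apply: contraNneq px; rewrite -Ey => /perm_inj ->; rewrite Ey.
exists phi2; split=> // z Az; rewrite out2 // twistE tpermD //.
  by apply: contraNneq Az => /perm_inj <-.
by apply: contraNneq Az => E; rewrite -Ap -E Ae.
Qed.

(** The isolated edge is another component, so [planar_join] inserts it at the corner between [a]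
    and [b]. If the given face is the empty walk, the face [y, eps y] is already the required
    one. *)
Lemma attach_edge phi y a b : planar eps phi -> face phi (a ++ b) ->
    phi y = eps y -> phi (eps y) = y -> y \notin a ++ b -> eps y \notin a ++ b ->
  exists phi', [/\ planar eps phi', face phi' (a ++ [:: y; eps y] ++ b)
    & forall z, z \notin a ++ [:: y; eps y] ++ b -> phi' z = phi z].
Proof.
move=> pl fab Ey Ey' yab y'ab.
have fy : face phi [:: y; eps y].
  by rewrite face_cons /= inE eq_sym eps_neq Ey Ey' !eqxx.
case Eu: (b ++ a) => [|u c].
- exists phi; have [Ea Eb] : a = [::] /\ b = [::] by case: (a) (b) Eu => [|? ?] [|? ?].
  by rewrite Ea Eb /=; split.
- rewrite face_rot Eu in fab.
  have yu : y \notin u :: c by rewrite -Eu mem_cat orbC -mem_cat.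
  have [f out] := face_join fab fy yu; exists (twist phi u y); split.
  + apply: planar_join => //.
    have cl : closed (glink eps phi) [in [:: y; eps y]].
      apply: intro_closed; first exact: conn_sym.
      move=> s t /orP[]/eqP <-; rewrite !inE => /orP[]/eqP->;
        by rewrite ?Ey ?Ey' ?epsK eqxx ?orbT.
    apply/negP => /(closed_connect cl); rewrite !inE eqxx /= => uy.
    have : u \in a ++ b by rewrite mem_cat orbC -mem_cat Eu mem_head.
    by case/orP: uy => /eqP->; apply/negP.
  + by move: f; rewrite -cat_cons -Eu -catA face_rot -catA.
  + move=> z zab; apply: out; move: zab; rewrite -cat_cons -Eu !mem_cat.
    by case: (z \in a); case: (z \in b); rewrite ?orbT ?orbF.
Qed.
End Surgery.
(** * Labels of paths and relative length *)

Section Words.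
Variable X : choiceType.
Implicit Types (w : seq (X * bool)) (a : X * bool).
Local Open Scope group_scope.

Definition wlabel w : freeGroup X := \prod_(a <- w) letter a.

Lemma wlabel_cons a w : wlabel (a :: w) = letter a * wlabel w.
Proof. exact: big_cons. Qed.

Lemma wlabel_nil : wlabel [::] = 1.
Proof. exact: big_nil. Qed.

Lemma wlabel_cat w1 w2 : wlabel (w1 ++ w2) = wlabel w1 * wlabel w2.
Proof. exact: big_cat. Qed.

Lemma wlabel_of_word w : wlabel w = of_word w.
Proof.
elim: w => [|a w IH]; first by rewrite wlabel_nil.
by rewrite wlabel_cons IH; apply/val_inj; rewrite /= -[LHS]/(reduce ([:: a] ++ reduce w)) reduce_catr.
Qed.

Lemma wlabel_val (u : freeGroup X) : wlabel (val u) = u.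
Proof. by rewrite wlabel_of_word; apply/val_inj; rewrite /= reduceK ?(valP u). Qed.

Lemma letter_sinv a : letter (sinv a) = (letter a)^-1.
Proof.
have: wlabel (sinv a :: [:: a]) = 1.
  by rewrite wlabel_of_word; apply/val_inj; rewrite /= sinvK eqxx.
rewrite !wlabel_cons wlabel_nil mulg1 => E.
by rewrite -[LHS]mulg1 -(mulgV (letter a)) mulgA E mul1g.
Qed.

Lemma wlabel_winv w : wlabel (winv w) = (wlabel w)^-1.
Proof.
elim: w => [|a w IH]; first by rewrite wlabel_nil invg1.
by rewrite /winv /= rev_cons -cats1 wlabel_cat -/(winv w) IH !wlabel_cons wlabel_nil
  mulg1 letter_sinv invMg.
Qed.

Lemma not_reduced_split (A : eqType) (B : Type) (f : B -> A * bool) (s : seq B) :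
    ~~ no_backtrack (map f s) ->
  exists p q x y, s = p ++ x :: y :: q /\ f y = sinv (f x).
Proof.
elim: s => [|x [|y s] IH] //=.
rewrite negb_and negbK => /orP[/eqP E|/IH[p [q [z [z' [-> E]]]]]].
  by exists [::], s, x, y.
by exists (x :: p), q, z, z'.
Qed.

Lemma wlabel1_not_reduced w : wlabel w = 1 -> w != [::] -> ~~ no_backtrack w.
Proof.
move=> w1; apply: contra => /reduceK <-.
by move/(congr1 val): w1; rewrite wlabel_of_word /= => ->.
Qed.

Lemma prod_conj_swap (x y : freeGroup X) : x * y = 1 -> y * x = 1.
Proof.
by move=> xy; rewrite -[y]mul1g -{1}(mulVg x) -(mulgA x^-1) xy mulg1 mulVg.
Qed.
End Words.

Section Paths.
Variables (X : choiceType) (Gam : xdigraph X).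
Implicit Types (u v : vert Gam) (a : edge Gam * bool) (p q : seq (edge Gam * bool)).
Local Open Scope group_scope.

Definition elab a : X * bool := (lab a.1, a.2).

Lemma path_labelE p : path_label p = wlabel (map elab p).
Proof. by rewrite /wlabel big_map. Qed.

Lemma path_label_cat p q : path_label (p ++ q) = path_label p * path_label q.
Proof. exact: big_cat. Qed.

Lemma path_label_cons a p : path_label (a :: p) = letter (elab a) * path_label p.
Proof. exact: big_cons. Qed.

Lemma path_label_nil : path_label ([::] : seq (edge Gam * bool)) = 1.
Proof. exact: big_nil. Qed.

Lemma elab_sinv a : elab (sinv a) = sinv (elab a).
Proof. by []. Qed.

Lemma src_sinv a : src (sinv a) = tgt a.
Proof. by case: a => e []. Qed.

Lemma tgt_sinv a : tgt (sinv a) = src a.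
Proof. by case: a => e []. Qed.

Lemma path_label_winv p : path_label (winv p) = (path_label p)^-1.
Proof.
rewrite !path_labelE -wlabel_winv; congr wlabel.
by rewrite /winv map_rev -!map_comp.
Qed.

Lemma is_path_cat u p q v :
  is_path u (p ++ q) v <-> exists2 w, is_path u p w & is_path w q v.
Proof.
elim: p u => [|a p IH] u /=.
  by split=> [|[w /eqP->]] //; exists u.
split=> [/andP[-> /IH[w pw qw]]|[w /andP[-> pw] qw]]; first by exists w.
by apply/IH; exists w.
Qed.

Lemma is_path_catI u p w q v : is_path u p w -> is_path w q v -> is_path u (p ++ q) v.
Proof. by move=> pw qw; apply/is_path_cat; exists w. Qed.

Lemma is_path_winv u p v : is_path u p v -> is_path v (winv p) u.
Proof.
elim: p u => [|a p IH] u /=; first by rewrite eq_sym.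
case/andP => /eqP <- /IH pv; rewrite /winv /= rev_cons -cats1.
by apply: is_path_catI pv _; rewrite /= src_sinv tgt_sinv !eqxx.
Qed.

Lemma is_path_reduce u p v : is_path u p v -> is_path u (reduce p) v.
Proof.
elim: p u => //= a p IH u /andP[au /IH]; case: (reduce p) => [|c w] /=.
  by rewrite au.
case: (c =P sinv a) => [->|_] /=; last by rewrite au.
by rewrite src_sinv tgt_sinv => /andP[_]; rewrite (eqP au).
Qed.

Lemma path_label_reduce p : path_label (reduce p) = path_label p.
Proof.
elim: p => //= a p; rewrite path_label_cons => <-.
case: (reduce p) => [|c w] /=; first by rewrite path_label_cons.
case: eqP => [->|_]; last by rewrite path_label_cons.
by rewrite path_label_cons elab_sinv letter_sinv mulgA mulgV mul1g.
Qed.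

(** [cycle_labels] asks for reduced cycles; free reduction of a path keeps its ends and its
    label. *)
Lemma closed_path_label v p : is_path v p v -> cycle_labels v (path_label p).
Proof.
move=> pv; exists (reduce p); split; first exact: is_path_reduce.
  exact: reduce_reduced.
exact: path_label_reduce.
Qed.

Lemma diamP u p v : is_path u p v ->
  exists p', is_path u p' v /\ (size p' <= diam Gam)%N.
Proof.
move=> pv; have : dist u v != None.
  rewrite /dist /min_ext; case: pselect => // -[]; exists (size p).
  by apply/asboolP; exists p.
move=> dn; have := @leq_bigmax_cond _ (fun uv : vert Gam * vert Gam => dist uv.1 uv.2 != None)
  (fun uv => odflt 0%N (dist uv.1 uv.2)) (u, v) dn.
move: dn; rewrite -/(diam Gam) /= {1 2}/dist /min_ext; case: pselect => //= exP _.
by case: ex_minnP => n /asboolP[p' [pp' <-]] _ le; exists p'.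
Qed.

Lemma folded_neq a c : folded Gam -> elab a = elab c -> a != c ->
  src a != src c /\ tgt a != tgt c.
Proof.
case: a c => [e s] [e' s'] [fo ft] [le <-] ne.
have {}ne : e <> e' by move=> E; rewrite E eqxx in ne.
by rewrite /src /tgt /=; case: s; split; apply/eqP => E; apply: ne; auto.
Qed.

End Paths.
Arguments elab {X Gam} a.

Section RelativeLength.
Variables (X : choiceType) (Gam : xdigraph X).
Implicit Types (u v : vert Gam) (p q : seq (edge Gam * bool)) (w : freeGroup X).
Local Open Scope group_scope.

Definition rl_gen w : Prop :=
  (exists l : X * bool, w = letter l) \/ (exists2 K, Omega Gam K & K w).

(** This is [|w|_H <= k]; as a bound on factorizations it is additive under products and avoids the
    minimum in [rel_length]. *)
Definition rl_le w (k : nat) : Prop :=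
  exists s : seq (freeGroup X), [/\ (size s <= k)%N, \prod_(x <- s) x = w
    & forall x, x \in s -> rl_gen x].

Lemma rl_leM w1 w2 k1 k2 : rl_le w1 k1 -> rl_le w2 k2 -> rl_le (w1 * w2) (k1 + k2).
Proof.
move=> [s1 [z1 <- g1]] [s2 [z2 <- g2]]; exists (s1 ++ s2); split.
- by rewrite size_cat leq_add.
- by rewrite big_cat.
- by move=> x; rewrite mem_cat => /orP[/g1|/g2].
Qed.

Lemma rl_leW w k1 k2 : (k1 <= k2)%N -> rl_le w k1 -> rl_le w k2.
Proof. by move=> le [s [z e g]]; exists s; split=> //; exact: leq_trans le. Qed.

Lemma rl_le_gen w : rl_gen w -> rl_le w 1.
Proof.
move=> g; exists [:: w]; split=> // [|x]; first by rewrite big_cons big_nil mulg1.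
by rewrite inE => /eqP->.
Qed.

Lemma rl_le_path p : rl_le (path_label p) (size p).
Proof.
elim: p => [|a p IH].
  by exists [::]; split=> //; rewrite path_label_nil big_nil.
rewrite path_label_cons -[size _]/(1 + size p)%N; apply: rl_leM => //.
by apply: rl_le_gen; left; exists (elab a).
Qed.

Lemma gamma_le N w k m : N w -> w <> 1 -> rl_le w k -> le_ext m (gamma Gam N) ->
  (m <= k)%N.
Proof.
move=> Nw w1 [s [zs es gs]].
have [j jk rj] : exists2 j, (j <= k)%N & rel_length Gam w = Some j.
  rewrite /rel_length /min_ext; case: pselect => [exP|[]]; last first.
    by exists (size s); apply/asboolP; exists s.
  exists (ex_minn exP) => //; case: ex_minnP => j _ min.
  by apply: leq_trans zs; apply: min; apply/asboolP; exists s.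
rewrite /gamma /min_ext; case: pselect => [exP|[]]; last first.
  by exists j; apply/asboolP; exists w.
rewrite /le_ext; case: ex_minnP => i _ min mi.
by apply: leq_trans mi (leq_trans _ jk); apply: min; apply/asboolP; exists w.
Qed.

Local Notation off := (offdiag_product Gam).

Definition off_pair (a c : edge Gam * bool) := (elab a == elab c) && (a != c).

(** In a folded graph two distinct edges with the same label differ at both ends, so every step
    avoids the diagonal. A first edge is needed to separate [u] from [v]. *)
Lemma off_path u v u' v' p q : folded Gam -> all2 off_pair p q -> p != [::] ->
    is_path u p u' -> is_path v q v' ->
  exists (x y : vert off) r, [/\ val x = (u, v), val y = (u', v') & is_path x r y].
Proof.
move=> fG; elim: p q u v => [|a p IH] [|c q] u v //= /andP[/andP[/eqP lac ac] pq] _.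
case/andP => /eqP <- pa /andP[/eqP <- qc].
have [sac tac] := folded_neq fG lac ac.
have [x [r [Ex Er]]] : exists x (r : edge off * bool), val x = (src a, src c) /\
    src r = x /\ val (tgt r) = (tgt a, tgt c).
  case: a c lac ac sac tac {pa qc} => [e s] [e' s'] [le <-] ac sac tac.
  have le' : lab e == lab e' by rewrite le.
  pose pe : edge (product_graph Gam Gam) := exist _ (e, e') le'.
  have Pe : ((orig pe).1 != (orig pe).2) && ((term pe).1 != (term pe).2).
    by move: sac tac; rewrite /src /tgt /=; case: (s) => /= -> ->.
  by exists (src ((exist _ pe Pe, s) : edge off * bool)), (exist _ pe Pe, s); case: (s).
case: p q pq pa qc IH => [|a' p] [|c' q] //=.
  move=> _ /eqP <- /eqP <- _; exists x, (tgt r), [:: r].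
  by rewrite /= Er.1 !eqxx Er.2.
move=> pq pa qc /(_ (c' :: q) _ _ pq isT pa qc)[y [z [t [Ey Ez yz]]]].
exists x, z, (r :: t); split=> //=; rewrite Er.1 eqxx /=.
by rewrite (_ : tgt r = y) //; apply/val_inj; exact: etrans Er.2 (esym Ey).
Qed.

Lemma off_path_proj (x y : vert off) r : is_path x r y -> exists p q,
  [/\ is_path (val x).1 p (val y).1, is_path (val x).2 q (val y).2,
      path_label p = path_label q & size p = size r].
Proof.
elim: r x => [|a r IH] x /=; first by move=> /eqP->; exists [::], [::]; rewrite /= !eqxx.
case/andP => /eqP <- /IH[p [q [pp qq pq sz]]].
case: a pp qq => [[[[e e'] le] Pe] s] /= pp qq.
exists ((e, s) :: p), ((e', s) :: q); rewrite /= sz !path_label_cons pq.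
rewrite /elab /= (eqP le : lab e = lab e').
by move: pp qq; rewrite /src /tgt /=; case: (s) => /= -> ->; rewrite !eqxx.
Qed.

(** A shortest path of the off-diagonal product with the same ends projects to a path [p'] of length
    at most the diameter. The remaining factor [p'^-1 p] labels a closed path at [u'] and one at
    [v'], so it has relative length at most 1; hence the [+ 1] in [C]. *)
Lemma piece_rl_le u v u' v' p q : folded Gam -> all2 off_pair p q ->
    is_path u p u' -> is_path v q v' ->
  rl_le (path_label p) (diam off + 1).
Proof.
move=> fG pq pp qq; have [->|pn] := eqVneq p [::].
  exact: rl_leW (rl_le_path [::]).
have [x [y [r [Ex Ey /diamP[r' [xy le]]]]]] := off_path fG pq pn pp qq.
have [p' [q' [pp' qq' pq' sz]]] := off_path_proj xy.
rewrite Ex Ey /= in pp' qq'.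
rewrite -[path_label p](mulVKg (path_label p')); apply: rl_leM.
  by apply: rl_leW (rl_le_path p'); rewrite sz.
apply/rl_le_gen; right; exists (cycle_labels u' `&` cycle_labels v').
  exists u', v'; split=> //; have := valP y; rewrite Ey /=.
  by [].
split; rewrite -path_label_winv.
  rewrite -path_label_cat; apply: closed_path_label.
  exact: is_path_catI (is_path_winv pp') pp.
rewrite path_label_winv pq' -path_label_winv.
have -> : path_label p = path_label q.
  rewrite !path_labelE; congr wlabel.
  elim: (p) (q) pq => [|a p1 IH] [|c q1] //= /andP[/andP[/eqP -> _]] /IH -> //.
rewrite -path_label_cat; apply: closed_path_label.
exact: is_path_catI (is_path_winv qq') qq.
Qed.

End RelativeLength.

(** * Reduction of a counterexample *)

Section NormalPart.
Variables (X : choiceType) (Gam : xdigraph X) (b : vert Gam).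
Variables (H N : set (freeGroup X)).
Hypotheses (NH : is_normal_in N H) (GH : is_stallings_graph b H).
Implicit Types (v : vert Gam) (p q : seq (edge Gam * bool)) (w : freeGroup X).
Local Open Scope group_scope.

(** The conjugate of [N] carried by the vertex [v]. Two paths from [b] to [v] differ by an element
    of [H], which normalizes [N], so any path may serve: this is [N_at_path]. *)
Definition N_at v w : Prop :=
  exists2 p, is_path b p v & N (path_label p * w * (path_label p)^-1).

Lemma N_conj p w : is_path b p b -> N w ->
  N (path_label p * w * (path_label p)^-1).
Proof.
move=> pb Nw; case: NH => _ _ /(_ w (path_label p)^-1 Nw).
rewrite conjgE invgK mulgA; apply; case: GH => _ _ -> _.
by rewrite -path_label_winv; apply: closed_path_label; exact: is_path_winv.
Qed.

Lemma N_at_path v p w : is_path b p v -> N_at v w ->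
  N (path_label p * w * (path_label p)^-1).
Proof.
move=> pv [q qv Nq]; have := N_conj (is_path_catI pv (is_path_winv qv)) Nq.
by rewrite path_label_cat path_label_winv !invMg !invgK !mulgA !mulgKV.
Qed.

Lemma N_at_exists v : exists p, is_path b p v.
Proof. by case: GH => c _ _ _; exact: c. Qed.

Lemma N_at1 v : N_at v 1.
Proof.
have [p pv] := N_at_exists v; exists p => //.
by rewrite mulg1 mulgV; case: NH => -[].
Qed.

Lemma N_atM v w1 w2 : N_at v w1 -> N_at v w2 -> N_at v (w1 * w2).
Proof.
have [p pv] := N_at_exists v => /(N_at_path pv) N1 /(N_at_path pv) N2; exists p => //.
case: NH => -[_ NM _] _ _; have := NM _ _ N1 N2.
by rewrite !mulgA mulgKV.
Qed.

Lemma N_atV v w : N_at v w -> N_at v w^-1.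
Proof.
case=> p pv Np; exists p => //; case: NH => -[_ _ NV] _ _; have := NV _ Np.
by rewrite !invMg invgK mulgA.
Qed.

Lemma N_atMl v w1 w2 : N_at v w1 -> N_at v (w1 * w2) -> N_at v w2.
Proof. by move=> /N_atV N1 /(N_atM N1); rewrite mulKg. Qed.

Lemma N_atMr v w1 w2 : N_at v w2 -> N_at v (w1 * w2) -> N_at v w1.
Proof. by move=> /N_atV N2 /N_atM /(_ N2); rewrite mulgK. Qed.

Lemma N_at_move v p v' w : is_path v p v' -> N_at v' w ->
  N_at v (path_label p * w * (path_label p)^-1).
Proof.
move=> pv [q qv' Nq]; exists (q ++ winv p).
  exact: is_path_catI qv' (is_path_winv pv).
by rewrite path_label_cat path_label_winv invMg !mulgA !mulgKV invgK mulgKV.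
Qed.

Lemma N_at_base w : N_at b w <-> N w.
Proof.
split=> [/(@N_at_path b [::] w (eqxx b))|Nw].
  by rewrite path_label_nil invg1 mul1g mulg1.
by exists [::]; rewrite /= ?eqxx // path_label_nil invg1 mul1g mulg1.
Qed.

(** * Faces and their lifts to the Stallings graph *)

Variables (D : finType) (eps : {perm D}) (l : D -> X * bool).
Hypotheses (epsK : involutive eps) (eps_neq : forall x, eps x != x).
Hypothesis l_eps : forall x, l (eps x) = sinv (l x).
Implicit Types (phi : {perm D}) (s t : seq D) (lam : D -> edge Gam * bool).

Definition slabel s := wlabel (map l s).

Lemma slabel_cat s t : slabel (s ++ t) = slabel s * slabel t.
Proof. by rewrite /slabel map_cat wlabel_cat. Qed.

Lemma slabel_cons x s : slabel (x :: s) = letter (l x) * slabel s.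
Proof. exact: wlabel_cons. Qed.

(** Lifts are read face by face: [lam (eps x)] need not be [sinv (lam x)], and the two sides of an
    edge of the map may lie over different edges of [Gam]. *)
Definition reads lam v s v' :=
  is_path v (map lam s) v' /\ {in s, forall x, elab (lam x) = l x}.

Lemma reads_label lam v s v' : reads lam v s v' -> path_label (map lam s) = slabel s.
Proof.
case=> _ El; rewrite path_labelE -map_comp; congr wlabel.
by apply/eq_in_map => x /El.
Qed.

Lemma reads_cat lam v s t v' :
  reads lam v (s ++ t) v' <-> exists2 u, reads lam v s u & reads lam u t v'.
Proof.
rewrite /reads map_cat; split=> [[/is_path_cat[u su tu] E]|[u [su Es] [tu Et]]].
  by exists u; split=> // x xs; apply: E; rewrite mem_cat xs ?orbT.
split; first exact: is_path_catI su tu.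
by move=> x; rewrite mem_cat => /orP[/Es|/Et].
Qed.

Lemma reads_cons lam v x s v' : reads lam v (x :: s) v' <->
  [/\ src (lam x) = v, elab (lam x) = l x & reads lam (tgt (lam x)) s v'].
Proof.
rewrite /reads /=; split=> [[/andP[/eqP E p] El]|[E Ex [p El]]].
  by split=> //; [exact/El/mem_head|split=> // z zs; apply: El; rewrite inE zs orbT].
by rewrite E eqxx; split=> // z; rewrite inE => /orP[/eqP->//|/El].
Qed.

(* [c] tells whether the lift of the closed walk [s] to [Gam] still closes up in
   the covering of [Gam] associated with [N]. *)
Definition kind lam s (c : bool) : Prop :=
  exists v, reads lam v s v /\ (N_at v (slabel s) <-> c).

Lemma kind_rot lam s t c : kind lam (s ++ t) c -> kind lam (t ++ s) c.
Proof.
case=> v [/reads_cat[u su tu] E]; exists u; split; first by apply/reads_cat; exists v.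
apply: iff_trans E; have sp := reads_label su; have tp := reads_label tu; rewrite !slabel_cat -sp -tp.
split=> [Nu|Nv].
  have := N_at_move su.1 Nu; by rewrite mulgA mulgK.
have := N_at_move tu.1 Nv; by rewrite mulgA mulgK.
Qed.

Lemma kind_face phi lam s t x c : face phi s -> face phi t -> x \in s -> x \in t ->
  kind lam s c -> kind lam t c.
Proof.
move=> fs ft xs xt; move: xs xt fs ft => /path.splitPr[s1 s2] /path.splitPr[t1 t2].
rewrite face_rot cat_cons => fs; rewrite face_rot cat_cons => /(face_head fs) E.
by move=> /kind_rot; rewrite cat_cons E -cat_cons => /kind_rot.
Qed.

(** A face with trivial label is accepted without a lift; the surgeries produce such faces, for
    instance the face [x, eps x] of an isolated edge. *)
Definition good lam s := slabel s = 1 \/ kind lam s true.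

Lemma slabel1_rot s t : slabel (s ++ t) = 1 -> slabel (t ++ s) = 1.
Proof. by rewrite !slabel_cat; exact: prod_conj_swap. Qed.

Lemma good_face phi lam s t x : face phi s -> face phi t -> x \in s -> x \in t ->
  good lam s -> good lam t.
Proof.
move=> fs ft xs xt [s1|ks]; last by right; exact: kind_face fs ft xs xt ks.
left; move: xs xt fs ft s1 => /path.splitPr[s1 s2] /path.splitPr[t1 t2].
rewrite face_rot cat_cons => fs; rewrite face_rot cat_cons => /(face_head fs) E.
by move=> /slabel1_rot; rewrite cat_cons E -cat_cons => /slabel1_rot.
Qed.

Lemma kind_false_neq1 lam s : kind lam s false -> slabel s <> 1.
Proof. by case=> v [_ [Nf _]] s1; have/Nf : N_at v (slabel s) by rewrite s1; exact: N_at1. Qed.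

(* The other components are left unconstrained, since a surgery may leave a second
   bad face in a component which it splits off. *)
Definition counterexample phi lam d0 : Prop :=
  planar eps phi /\ exists s0, [/\ d0 \in s0, face phi s0, kind lam s0 false
    & forall d, conn eps phi d0 d -> d \notin s0 ->
        exists s, [/\ d \in s, face phi s & good lam s]].

(** No surgery removes a dart, so progress is measured on the component of [d0] alone. *)
Definition csize phi d0 := #|[pred z | conn eps phi d0 z]|.

Lemma csize_lt phi phi' d0 d0' z : subrel (conn eps phi') (conn eps phi) ->
    conn eps phi d0 d0' -> conn eps phi d0 z -> ~~ conn eps phi' d0' z ->
  (csize phi' d0' < csize phi d0)%N.
Proof.
move=> sub c0 cz ncz; apply: proper_card; apply/properP; split; last by exists z.
by apply/fintype.subsetP => y; rewrite !inE => /sub; exact: connect_trans.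
Qed.

Lemma isolated_conn phi x y z : phi x = eps x -> phi (eps x) = x ->
  conn eps phi y z -> z \in [:: x; eps x] -> y \in [:: x; eps x].
Proof.
move=> Ex Ex' yz; have cl : closed (glink eps phi) [in [:: x; eps x]].
  apply: intro_closed; first exact: conn_sym.
  by move=> s t /orP[]/eqP <-; rewrite !inE => /orP[]/eqP->; rewrite ?Ex ?Ex' ?epsK eqxx ?orbT.
by rewrite (closed_connect cl yz).
Qed.

Lemma face_disj phi s t d z : face phi s -> face phi t -> d \in t -> d \notin s ->
  z \in t -> z \notin s.
Proof. by move=> fs ft dt ds zt; apply: contra ds => zs; rewrite (face_mem fs ft zs zt). Qed.

Lemma kind_eq lam lam' s s' c : map lam s = map lam' s' -> map l s = map l s' ->
  kind lam s c -> kind lam' s' c.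
Proof.
move=> El Es [v [[ps rs] Nv]]; exists v; split; last by rewrite /slabel -Es.
split; first by rewrite -El.
have : map elab (map lam s) = map l s by rewrite -map_comp; apply/eq_in_map => x /rs.
by rewrite El Es -map_comp => /eq_in_map.
Qed.

(** Deleting the edge of [y] glues the two sides of the digon: in the face of [eps y], which is
    another face as [y != eps x], the dart [eps y] is replaced by [x], which has the same letter.
    The component loses [y], now isolated. *)
Lemma remove_bigon phi lam d0 x y : counterexample phi lam d0 ->
    face phi [:: x; y] -> l y = sinv (l x) -> y != eps x -> conn eps phi d0 y ->
  exists phi' lam' d0', counterexample phi' lam' d0' /\
    (csize phi' d0' < csize phi d0)%N.
Proof.
move=> [pl [s0 [d0s0 fs0 ks0 gd]]] fxy lxy yex cy.
have fyx : face phi [:: y; x] by rewrite (face_rot _ [:: y] [:: x]).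
have xy : x != y by case/andP: fxy => /=; rewrite inE => /andP[].
have [b0 fb] := face_exists phi (eps y).
have ey : eps y \notin [:: y; x].
  rewrite !inE negb_or eps_neq /=; apply: contraNneq yex => <-.
  by rewrite epsK.
have [phi' [pl' fbx [Ey Ey'] out sub]] := delete_edge epsK pl fyx fb ey.
have {fbx} fx : face phi' (x :: b0) by rewrite -cat1s face_rot.
have dis z : z \in [:: y; x] -> z \notin eps y :: b0.
  by move=> zy; apply: contra ey => zb; rewrite (face_mem fyx fb zy zb) mem_head.
have d0xy : d0 \notin [:: y; x].
  apply/negP => d0xy; have := kind_face fs0 fyx d0s0 d0xy ks0.
  move/kind_false_neq1; apply.
  by rewrite !slabel_cons lxy letter_sinv /slabel /= wlabel_nil mulg1 mulVg.
(* [x] takes over the lift of [eps y], so the face keeps its lifted walk. *)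
pose lam' z := if z == x then lam (eps y) else lam z.
have lam'_out t : x \notin t -> map lam t = map lam' t.
  move=> xt; apply/eq_in_map => z zt; rewrite /lam'; case: eqP => // E.
  by rewrite -E zt in xt.
have lx : l x = l (eps y) by rewrite l_eps lxy sinvK.
have Elam : map lam (eps y :: b0) = map lam' (x :: b0).
  rewrite /= {1}/lam' eqxx -lam'_out //; have := dis x; rewrite !inE eqxx orbT.
  by move=> /(_ isT) /norP[].
have El : map l (eps y :: b0) = map l (x :: b0) by rewrite /= lx.
have fyy : face phi' [:: y; eps y].
  by rewrite face_cons /= inE eq_sym eps_neq Ey Ey' !eqxx.
have cx : conn eps phi d0 x.
  apply: connect_trans cy _; apply: face_conn fyx _ _; by rewrite !inE eqxx ?orbT.
(* Wherever the bad face is, a dart lies on [x :: b0], on the isolated edge, or on an untouched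
   face. *)
have gd' (s0' : seq D) d : conn eps phi d0 d -> d \notin s0' ->
    (d \in x :: b0 -> eps y \notin s0) -> (d \notin eps y :: b0 -> d \notin s0) ->
    exists s, [/\ d \in s, face phi' s & good lam' s].
  move=> cd ds0' xb xs; have [dx|dx] := boolP (d \in x :: b0).
    have [|t [yt ft gt]] := gd (eps y) _ (xb dx).
      exact: connect_trans cy (conn_eps _ _ _).
    exists (x :: b0); split=> //.
    have [E|ks] := good_face ft fb yt (mem_head _ _) gt; [left|right].
      by rewrite /slabel -El.
    exact: kind_eq Elam El ks.
  have [dy|dy] := boolP (d \in [:: y; eps y]).
    exists [:: y; eps y]; split=> //; left.
    by rewrite !slabel_cons l_eps letter_sinv /slabel /= wlabel_nil mulg1 mulgV.
  have dyx : d \notin [:: y; x] by move: dx dy; rewrite !inE !negb_or => /andP[-> _] /andP[-> _].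
  have db : d \notin eps y :: b0.
    by move: dx dy; rewrite !inE !negb_or => /andP[_ ->] /andP[_ ->].
  have [t [dt ft gt]] := gd d cd (xs db).
  exists t; split=> //.
    by apply: (face_eq _ ft) => z zt; apply: out;
      [exact: face_disj fyx ft dt dyx zt|exact: face_disj fb ft dt db zt].
  case: gt => [|kt]; [by left|right; apply: kind_eq kt => //; apply: lam'_out].
  apply/negP => xt; have := face_disj fyx ft dt dyx xt.
  by rewrite !inE eqxx orbT.
have fin d0' (s0' : seq D) : conn eps phi d0 d0' -> d0' \notin [:: y; eps y] ->
    d0' \in s0' -> face phi' s0' -> kind lam' s0' false ->
    (forall d, conn eps phi d0 d -> d \notin s0' ->
        exists s, [/\ d \in s, face phi' s & good lam' s]) ->
    exists phi' lam' d0', counterexample phi' lam' d0' /\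
      (csize phi' d0' < csize phi d0)%N.
  move=> c0 d0y d0s fs ks g; exists phi', lam', d0'; split.
    split=> //; exists s0'; split=> // d cd; apply: g.
    by apply: connect_trans c0 _; exact: sub.
  apply: (csize_lt sub c0 cy); apply: contra d0y => /(isolated_conn Ey Ey'); apply.
  by rewrite mem_head.
(* If the bad face is that of [eps y], its base dart moves to [x], since [d0] may be [eps y], now
   isolated. *)
have [d0b|d0b] := boolP (d0 \in eps y :: b0).
  have Es0 := face_mem fs0 fb d0s0 d0b.
  apply: (fin x (x :: b0)) => //.
  - by move: ey; rewrite !inE !negb_or xy [x == eps y]eq_sym => /andP[_ ->].
  - by rewrite mem_head.
  - exact: kind_eq Elam El (kind_face fs0 fb d0s0 d0b ks0).
  - by move=> d cd dxb; apply: (gd' (x :: b0) d cd dxb) => [dx|]; [rewrite dx in dxb|rewrite Es0].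
have s0b z : z \in s0 -> z \notin eps y :: b0 by exact: face_disj fb fs0 d0s0 d0b.
have s0xy z : z \in s0 -> z \notin [:: y; x] by exact: face_disj fyx fs0 d0s0 d0xy.
have xs0 : x \notin s0 by apply/negP => /s0xy; rewrite !inE eqxx orbT.
apply: (fin d0 s0) => //.
- exact: connect0.
- move: d0xy d0b; rewrite !inE !negb_or => /andP[-> _] /andP[-> _] //.
- by apply: (face_eq _ fs0) => z zs; apply: out; [exact: s0xy|exact: s0b].
- by apply: kind_eq ks0 => //; exact: lam'_out.
move=> d cd ds0; apply: (gd' s0 d cd ds0) => // _; apply/negP => /s0b.
by rewrite mem_head.
Qed.

Lemma csize_le phi phi' d0 : subrel (conn eps phi') (conn eps phi) ->
  (csize phi' d0 <= csize phi d0)%N.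
Proof.
by move=> sub; apply/subset_leq_card/fintype.subsetP => z; rewrite !inE => /sub.
Qed.

Lemma bad_face_disj phi s t d0 lam : face phi s -> face phi t -> d0 \in s ->
    kind lam s false -> slabel t = 1 -> d0 \notin t.
Proof.
move=> fs ft ds ks t1; apply/negP => dt.
exact: kind_false_neq1 (kind_face fs ft ds dt ks) t1.
Qed.

(** A nonempty word with trivial label has adjacent inverse letters, here at [x] and [y]. The digon
    [x, y] is cut off, which creates only faces with trivial label, and then folded by
    [remove_bigon]; if the cut separates [d0] from [y], the component has already shrunk. *)
Lemma remove_trivial_face phi lam d0 d s : counterexample phi lam d0 ->
    conn eps phi d0 d -> d \in s -> face phi s -> slabel s = 1 ->
  exists phi' lam' d0', counterexample phi' lam' d0' /\
    (csize phi' d0' < csize phi d0)%N.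
Proof.
move=> [pl [s0 [d0s0 fs0 ks0 gd]]] cd ds fs s1.
have [|p [q [x [y [Es lxy]]]]] := @not_reduced_split _ _ l s.
  apply: wlabel1_not_reduced => //; by case: (s) ds.
pose c := q ++ p; have Exyc : x :: y :: c = (x :: y :: q) ++ p by [].
have fc : face phi (x :: y :: c).
  by rewrite Exyc face_rot -Es.
have sc z : (z \in x :: y :: c) = (z \in s).
  by rewrite Exyc Es !mem_cat orbC.
have c1 : slabel c = 1.
  have : slabel (x :: y :: c) = 1.
    by rewrite Exyc; apply: slabel1_rot; rewrite -Es.
  by rewrite !slabel_cons lxy letter_sinv mulKVg.
have xy1 : slabel [:: x; y] = 1.
  by rewrite !slabel_cons lxy letter_sinv /slabel /= wlabel_nil mulg1 mulgV.
have d0s : d0 \notin x :: y :: c.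
  by rewrite sc; exact: (bad_face_disj fs0 fs d0s0 ks0 s1).
have [phi1 [pl1 fxy1 fc1 out sub]] : exists phi1, [/\ planar eps phi1,
    face phi1 [:: x; y], face phi1 c, (forall z, z \notin x :: y :: c -> phi1 z = phi z)
    & subrel (conn eps phi1) (conn eps phi)].
  case Ec: c fc => [|w c'] fc; first by exists phi; split.
  have [f1 f2 out] := @face_split _ phi x w [:: y] c' fc.
  have xc : x \in [:: x, y, w & c'] by rewrite mem_head.
  have wc : w \in [:: x, y, w & c'] by rewrite !inE eqxx !orbT.
  exists (twist phi x w); split=> //.
    apply: planar_split; rewrite ?(face_porbit fc xc wc) //.
    by case/andP: fc => /=; rewrite !inE !negb_or => /andP[/and3P[]].
  by apply: conn_twist; exact: face_conn fc xc wc.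
have ce1 : counterexample phi1 lam d0.
  split=> //; exists s0; split=> //.
    by apply: (face_eq _ fs0) => z zs; apply: out; exact: face_disj fc fs0 d0s0 d0s zs.
  move=> e ce es0; have [exy|exy] := boolP (e \in [:: x; y]).
    by exists [:: x; y]; split=> //; left.
  have [ec|ec] := boolP (e \in c); first by exists c; split=> //; left.
  have ef : e \notin x :: y :: c.
    by move: exy ec; rewrite !inE !negb_or => /andP[-> ->] ->.
  have [t [et ft gt]] := gd e (sub _ _ ce) es0; exists t; split=> //.
  by apply: (face_eq _ ft) => z zt; apply: out; exact: face_disj fc ft et ef zt.
have cy : conn eps phi d0 y.
  apply: connect_trans cd _; apply: face_conn fs ds _.
  by rewrite -sc !inE eqxx orbT.
have [cy1|cy1] := boolP (conn eps phi1 d0 y); last first.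
  exists phi1, lam, d0; split=> //; exact: csize_lt sub (connect0 _ _) cy cy1.
have [phi' [lam' [d0' [ce' lt]]]] : exists phi' lam' d0',
    counterexample phi' lam' d0' /\ (csize phi' d0' < csize phi1 d0)%N.
  (* If [y] were [eps x], the component of [y] would consist of [x] and [y]; but it contains [d0],
     which is not on the trivial face. *)
  apply: (remove_bigon ce1 fxy1 lxy _ cy1); apply/negP => /eqP Ey.
  move: fxy1; rewrite face_cons /= !andbT => /and3P[_ /eqP Ex /eqP Ey1].
  have := isolated_conn (x := x) _ _ cy1; rewrite Ey Ex -Ey Ey1.
  move=> /(_ erefl erefl); rewrite !inE eqxx orbT => /(_ isT) d0xy.
  by move: d0s; rewrite !inE; case/orP: d0xy => ->; rewrite ?orbT.
exists phi', lam', d0'; split=> //; apply: leq_trans lt _; exact: csize_le.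
Qed.

(** * Edges with the same lift on both sides *)

Definition no_trivial_face phi d0 := forall d s, conn eps phi d0 d -> d \in s ->
  face phi s -> slabel s <> 1.

Lemma kind_of_face phi lam d0 d s : counterexample phi lam d0 ->
    no_trivial_face phi d0 -> conn eps phi d0 d -> d \in s -> face phi s ->
  kind lam s (d0 \notin s).
Proof.
move=> [pl [s0 [d0s0 fs0 ks0 gd]]] nt cd ds fs.
have [d0s|d0s] := boolP (d0 \in s); first exact: kind_face fs0 fs d0s0 d0s ks0.
have ds0 : d \notin s0 by apply: contra d0s => ds0; rewrite -(face_mem fs0 fs ds0 ds).
have [t [dt ft [t1|kt]]] := gd d cd ds0; first by case: (nt d t).
exact: kind_face ft fs dt ds kt.
Qed.

(* Both walks lift, so that the letters at the deleted edge cancel in [Gam]. *)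
Lemma kind_merge lam x a b0 (c1 c2 : bool) : lam (eps x) = sinv (lam x) -> c1 || c2 ->
    kind lam (x :: a) c1 -> kind lam (eps x :: b0) c2 ->
  kind lam (b0 ++ a) (c1 && c2).
Proof.
move=> lamx c12 [v [/reads_cons[sx ex ra] N1]] [t [/reads_cons[sy ey rb] N2]].
rewrite lamx src_sinv in sy; rewrite lamx tgt_sinv sx in rb; rewrite sy in ra.
exists v; split; first by apply/reads_cat; exists t.
have pxt : is_path v [:: lam x] t by rewrite /= sx sy !eqxx.
have lx : path_label [:: lam x] = letter (l x).
  by rewrite path_label_cons path_label_nil mulg1 ex.
pose u := slabel b0 * (letter (l x))^-1.
have Nu : N_at v u <-> c2.
  apply: iff_trans N2; rewrite slabel_cons l_eps letter_sinv; split=> N3.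
    have := N_at_move (is_path_winv pxt) N3.
    by rewrite path_label_winv lx invgK /u !mulgA mulgKV.
  by have := N_at_move pxt N3; rewrite lx /u !mulgA mulgV mul1g.
have -> : slabel (b0 ++ a) = u * slabel (x :: a).
  by rewrite /u slabel_cons slabel_cat -mulgA mulKg.
case: c1 c12 N1 => c12 N1; case: c2 c12 N2 Nu => //= _ _ Nu; split=> // N3.
- by apply: N_atM; [apply/Nu|apply/N1].
- by apply/Nu; apply: N_atMr N3; apply/N1.
- by apply/N1; apply: N_atMl N3; apply/Nu.
Qed.

(** The edge is deleted. By [kind_merge] the merged face is bad exactly when one of the two faces
    was, and they are not both bad since [d0] lies on at most one of them. The component loses
    [x]. *)
Lemma merge_faces phi lam d0 x a : counterexample phi lam d0 ->
    no_trivial_face phi d0 -> conn eps phi d0 x -> lam (eps x) = sinv (lam x) ->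
    face phi (x :: a) -> eps x \notin x :: a ->
  exists phi' lam' d0', counterexample phi' lam' d0' /\
    (csize phi' d0' < csize phi d0)%N.
Proof.
move=> ce nt cx lamx fa exa; have [b0 fb] := face_exists phi (eps x).
have cex : conn eps phi d0 (eps x) by exact: connect_trans cx (conn_eps _ _ _).
have ka := kind_of_face ce nt cx (mem_head _ _) fa.
have kb := kind_of_face ce nt cex (mem_head _ _) fb.
have [phi' [pl' fba [Ex Ex'] out sub]] := delete_edge epsK ce.1 fa fb exa.
case: ce => pl [s0 [d0s0 fs0 ks0 gd]].
have dis z : z \in x :: a -> z \notin eps x :: b0.
  by move=> za; apply: contra exa => zb; rewrite (face_mem fa fb za zb) mem_head.
have c12 : (d0 \notin x :: a) || (d0 \notin eps x :: b0).
  by rewrite -implybE; apply/implyP => /dis.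
have := kind_merge lamx c12 ka kb => kba.
have iso e : e \notin [:: x; eps x] -> ~~ conn eps phi' e x.
  by apply: contra => /(isolated_conn Ex Ex'); apply; exact: mem_head.
have fxx : face phi' [:: x; eps x].
  by rewrite face_cons /= inE eq_sym eps_neq Ex Ex' !eqxx.
have bax z : z \in b0 ++ a -> z \notin [:: x; eps x].
  move=> zba; rewrite !inE negb_or; apply/andP; split; apply: contraTneq zba => ->.
    rewrite mem_cat negb_or; have := dis x (mem_head _ _); rewrite inE => /norP[_ ->].
    by case/andP: fa => /= /andP[].
  rewrite mem_cat negb_or; move: exa; rewrite inE => /norP[_ ->].
  by case/andP: fb => /= /andP[-> _].
have gd' (s0' : seq D) d : conn eps phi d0 d -> d \notin s0' ->
    (d \in b0 ++ a -> (d0 \notin x :: a) && (d0 \notin eps x :: b0)) ->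
    (d \notin x :: a -> d \notin eps x :: b0 -> d \notin s0) ->
    exists s, [/\ d \in s, face phi' s & good lam s].
  move=> cd ds0' hba hs; have [dba|dba] := boolP (d \in b0 ++ a).
    by exists (b0 ++ a); split=> //; right; rewrite -(hba dba).
  have [dx|dx] := boolP (d \in [:: x; eps x]).
    exists [:: x; eps x]; split=> //; left.
    by rewrite !slabel_cons l_eps letter_sinv /slabel /= wlabel_nil mulg1 mulgV.
  have da : d \notin x :: a.
    by move: dba dx; rewrite mem_cat !inE !negb_or => /andP[_ ->] /andP[-> _].
  have db : d \notin eps x :: b0.
    by move: dba dx; rewrite mem_cat !inE !negb_or => /andP[-> _] /andP[_ ->].
  have [t [dt ft gt]] := gd d cd (hs da db); exists t; split=> //.
  by apply: (face_eq _ ft) => z zt; apply: out;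
    [exact: face_disj fa ft dt da zt|exact: face_disj fb ft dt db zt].
have [d0ab|d0ab] := boolP ((d0 \notin x :: a) && (d0 \notin eps x :: b0)).
  have [d0a d0b] := andP d0ab; exists phi', lam, d0; split.
    split=> //; exists s0; split=> //.
      apply: (face_eq _ fs0) => z zs; apply: out; first exact: face_disj fa fs0 d0s0 d0a zs.
      exact: face_disj fb fs0 d0s0 d0b zs.
    by move=> d /sub cd ds0; apply: (gd' s0 d cd ds0).
  apply: (csize_lt sub (connect0 _ _) cx); apply: iso; rewrite !inE negb_or.
  by move: d0a d0b; rewrite !inE !negb_or => /andP[-> _] /andP[-> _].
rewrite (negbTE d0ab) in kba.
(* The bad face was merged. Its base moves to a dart of the merged walk, since [d0] may be on the
   deleted edge; this walk is not empty because a bad face has nontrivial label. *)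
have [e eba] : exists e, e \in b0 ++ a.
  have := kind_false_neq1 kba; case: (b0 ++ a) => [[]|e s _]; first exact: wlabel_nil.
  by exists e; exact: mem_head.
have ce' : conn eps phi d0 e.
  move: eba; rewrite mem_cat => /orP[eb|ea].
    by apply: connect_trans cex (face_conn _ fb _ _); rewrite ?mem_head // inE eb orbT.
  by apply: connect_trans cx (face_conn _ fa _ _); rewrite ?mem_head // inE ea orbT.
exists phi', lam, e; split; last by apply: (csize_lt sub ce' cx); apply: iso; exact: bax.
split=> //; exists (b0 ++ a); split=> // d /sub cd dba.
apply: (gd' (b0 ++ a) d (connect_trans ce' cd) dba) => [d1|da db]; first by rewrite d1 in dba.
apply/negP => ds0; move: d0ab; rewrite negb_and !negbK => /orP[d0a|d0b].
  by rewrite -(face_mem fs0 fa d0s0 d0a) ds0 in da.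
by rewrite -(face_mem fs0 fb d0s0 d0b) ds0 in db.
Qed.

(** The lift runs along one edge at [x] and back at [eps x], so the two halves [s1] and [s2] of the
    face lift to closed paths at the same vertex; pinching puts them into different components. *)
Lemma pinch_face phi lam d0 x a (w : D) b0 : counterexample phi lam d0 ->
    no_trivial_face phi d0 -> conn eps phi d0 x -> lam (eps x) = sinv (lam x) ->
    face phi (x :: a ++ eps x :: w :: b0) ->
  exists phi' lam' d0', counterexample phi' lam' d0' /\
    (csize phi' d0' < csize phi d0)%N.
Proof.
move=> ce nt cx lamx fs; set s := x :: a ++ _ in fs.
have xs : x \in s := mem_head _ _.
have ws : w \in s by rewrite !(inE, mem_cat) eqxx !orbT.
have ks := kind_of_face ce nt cx xs fs.
have [phi' [pl' f1 f2 nxw [out sub]]] := pinch_edge ce.1 fs.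
set s1 := x :: a ++ _ in f1; set s2 := w :: b0 in f2.
have Es : s = s1 ++ s2 by rewrite /s /s1 /= -catA.
case: ce => pl [s0 [d0s0 fs0 ks0 gd]].
have cw : conn eps phi d0 w by apply: connect_trans cx (face_conn _ fs xs ws).
have [v [r1 r2 Nv]] : exists v, [/\ reads lam v s1 v, reads lam v s2 v
    & N_at v (slabel s1 * slabel s2) <-> d0 \notin s].
  case: ks => v [+ Nv]; rewrite Es => /reads_cat[u r1 r2]; exists v.
  have E : u = v.
    move: (r1); rewrite /s1 => /reads_cons[sx _ /reads_cat[t _ /reads_cons[_ _ [/= /eqP <- _]]]].
    by rewrite lamx tgt_sinv.
  by rewrite E in r1 r2; rewrite -slabel_cat -Es.
have kc s' : reads lam v s' v -> N_at v (slabel s') -> kind lam s' true.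
  by move=> r Ns; exists v; split.
have kf s' : reads lam v s' v -> ~ N_at v (slabel s') -> kind lam s' false.
  by move=> r Ns; exists v; split.
have good_out d : conn eps phi d0 d -> d \notin s -> d \notin s0 ->
    exists s, [/\ d \in s, face phi' s & good lam s].
  move=> cd dns ds0; have [t [dt ft gt]] := gd d cd ds0; exists t; split=> //.
  by apply: (face_eq _ ft) => z zt; apply: out; exact: face_disj fs ft dt dns zt.
have s0s z : d0 \notin s -> z \in s0 -> z \notin s by exact: face_disj fs fs0 d0s0.
(* A component of the pinched map which carries a bad face and does not contain [d0]. *)
have new d0' z s' s'' : conn eps phi d0 d0' -> conn eps phi d0 z ->
    ~~ conn eps phi' d0' z -> d0' \in s' -> z \in s'' -> face phi' s' -> face phi' s'' ->
    s =i s' ++ s'' -> kind lam s' false -> d0 \in s \/ ~~ conn eps phi' d0 d0' ->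
    exists phi' lam' d0', counterexample phi' lam' d0' /\
      (csize phi' d0' < csize phi d0)%N.
  move=> c0 cz ncz ds' zs'' f' f'' Es' k' nc.
  exists phi', lam, d0'; split; last exact: (csize_lt sub c0 cz ncz).
  split=> //; exists s'; split=> // d cd dns'.
  have dns : d \notin s.
    rewrite Es' mem_cat negb_or dns' /=; apply: contra ncz => dz.
    by apply: connect_trans cd _; exact: face_conn f'' dz zs''.
  have [d0s|d0s] := boolP (d0 \in s).
    apply: good_out => //; first exact: connect_trans c0 (sub _ _ cd).
    by rewrite (face_mem fs0 fs d0s0 d0s).
  case: nc => [|nc]; first by rewrite (negbTE d0s).
  apply: good_out => //; first exact: connect_trans c0 (sub _ _ cd).
  apply: contra nc => dsz.
  have fs0' : face phi' s0 by apply: (face_eq _ fs0) => y ys; apply: out; exact: s0s.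
  by apply: connect_trans (face_conn _ fs0' d0s0 dsz) _; rewrite /conn conn_sym.
have Exs : s =i s2 ++ s1 by move=> z; rewrite Es !mem_cat orbC.
have new1 := new x w s1 s2 cx cw nxw (mem_head _ _) (mem_head _ _) f1 f2.
have nwx : ~~ conn eps phi' w x by rewrite /conn conn_sym.
have new2 := new w x s2 s1 cw cx nwx (mem_head _ _) (mem_head _ _) f2 f1 Exs.
rewrite -Es in new1; have {}new1 := new1 (fun=> erefl).
(* [N_at v] is closed under products and inverses. If both halves are good, so was the face, and the
   old bad face persists. If exactly one is bad, the face was the bad one, and the component of the
   bad half is a smaller counterexample. *)
have [N1|N1] := pselect (N_at v (slabel s1)); have [N2|N2] := pselect (N_at v (slabel s2)).
- have d0s : d0 \notin s by apply/Nv; exact: N_atM.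
  have ce' : counterexample phi' lam d0.
    split=> //; exists s0; split=> //.
      by apply: (face_eq _ fs0) => y ys; apply: out; exact: s0s.
    move=> d /sub cd ds0; have [|dns] := boolP (d \in s); last exact: good_out.
    rewrite Es mem_cat => /orP[d1|d2].
      by exists s1; split=> //; right; exact: kc.
    by exists s2; split=> //; right; exact: kc.
  have [c1|c1] := boolP (conn eps phi' d0 x).
    have nw : ~~ conn eps phi' d0 w.
      apply: contra nxw => c2; apply: connect_trans c2; rewrite conn_sym; exact: c1.
    by exists phi', lam, d0; split=> //; exact: csize_lt sub (connect0 _ _) cw nw.
  by exists phi', lam, d0; split=> //; exact: csize_lt sub (connect0 _ _) cx c1.
- apply: new2; first exact: kf.
  left; apply: contraT => /Nv Ns; case: N2; exact: N_atMl Ns.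
- apply: new1; first exact: kf.
  left; apply: contraT => /Nv Ns; case: N1; exact: N_atMr Ns.
(* Both halves are bad. Unless the pinched face was itself the bad one, the half to keep is one
   whose component avoids [d0]. *)
have [d0s|d0s] := boolP (d0 \in s); first by apply: new1; [exact: kf|left].
have [c1|c1] := boolP (conn eps phi' d0 x); last by apply: new1; [exact: kf|right].
apply: new2; [exact: kf|right]; apply: contra nxw => c2.
by apply: connect_trans c2; rewrite conn_sym; exact: c1.
Qed.

(** The edge separates two faces, which are merged, or lies twice on one face, which is pinched.
    Pinching needs a dart after [eps x]; failing that, [x] and [eps x] exchange roles. The face
    [x, eps x] alone is excluded by its trivial label. *)
Lemma cancel_edge phi lam d0 x : counterexample phi lam d0 ->
    no_trivial_face phi d0 -> conn eps phi d0 x -> lam (eps x) = sinv (lam x) ->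
  exists phi' lam' d0', counterexample phi' lam' d0' /\
    (csize phi' d0' < csize phi d0)%N.
Proof.
move=> ce nt cx lamx; have [a fa] := face_exists phi x.
have [exa|] := boolP (eps x \in x :: a); last by move=> exa; exact: (merge_faces ce nt cx lamx fa exa).
move: exa; rewrite inE (negbTE (eps_neq x)) /= => exa.
case/path.splitPr: exa fa => p [|w q] fa; last exact: (pinch_face ce nt cx lamx fa).
have cex : conn eps phi d0 (eps x) by exact: connect_trans cx (conn_eps _ _ _).
case: p fa => [|w p] fa.
  case: (nt x _ cx (mem_head _ _) fa).
  by rewrite !slabel_cons l_eps letter_sinv /slabel /= wlabel_nil mulg1 mulgV.
apply: (@pinch_face phi lam d0 (eps x) [::] w p ce nt cex).
  by rewrite epsK lamx sinvK.
by move: fa; rewrite epsK -cat_cons face_rot.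
Qed.

(** * Counting orbits and components *)

Lemma orbn_weight (s : {perm D}) (f : D -> nat) k :
  (forall x, k <= \sum_(d in porbit s x) f d)%N -> (k * orbn s <= \sum_d f d)%N.
Proof.
move=> le; rewrite (partition_big (porbit s) [in porbits s]) /=; last first.
  by move=> d _; exact: imset_f.
rewrite mulnC -sum_nat_const; apply: leq_sum => _ /imsetP[x _ ->].
apply: leq_trans (le x) _; apply: eq_leq; apply: eq_bigl => d.
by rewrite eq_porbit_mem.
Qed.

Lemma sum_seq_le (A : {set D}) (s : seq D) (f : D -> nat) : uniq s ->
  {subset s <= A} -> (\sum_(d <- s) f d <= \sum_(d in A) f d)%N.
Proof.
move=> us sA; rewrite big_uniq //= [X in (_ <= X)%N](bigID [in s]) /=.
apply: leq_trans (leq_addr _ _); apply: eq_leq; apply: eq_bigl => d.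
by case ds: (d \in s); rewrite ?andbF // sA.
Qed.

(** Outside [A] every component is an isolated edge, with two darts, and [A] contains at least one
    further component. *)
Lemma card_le_ncomp phi (A : pred D) d0 : A d0 ->
    (forall x, A (phi x) = A x) -> (forall x, A (eps x) = A x) ->
    (forall x, ~~ A x -> phi x = eps x) ->
  (#|[predC A]| + 2 <= (ncomp eps phi).*2)%N.
Proof.
move=> Ad0 Ap Ae iso; rewrite /ncomp (n_compC A) doubleD addnC.
have clA : closed (glink eps phi) A.
  by move=> x y /orP[]/eqP <-; rewrite !unfold_in ?Ap ?Ae.
apply: leq_add.
  rewrite -[2]/(1.*2) leq_double; apply/card_gt0P; exists (root (glink eps phi) d0).
  rewrite !inE /= (roots_root (conn_sym _ _)) /=.
  by rewrite -(closed_connect clA (connect_root _ _)).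
(* [R] has one dart of each isolated edge; together with its image under [eps] it covers the
   complement of [A]. *)
set R := [predI roots (glink eps phi) & [predC A]].
have -> : n_comp (glink eps phi) [predC A] = #|R| by apply: eq_card.
rewrite -addnn -{2}(card_image (@perm_inj _ eps) R) -cardUI.
apply: leq_trans (leq_addr _ _); apply: subset_leq_card.
apply/fintype.subsetP => x Ax; rewrite inE.
have [iso1 iso2] : phi x = eps x /\ phi (eps x) = x.
  by rewrite !iso ?Ae // epsK.
have rx : conn eps phi x (root (glink eps phi) x) := connect_root _ _.
have Ar : root (glink eps phi) x \in [predC A].
  by rewrite inE /= -(closed_connect clA rx).
have := isolated_conn iso1 iso2 (y := root (glink eps phi) x) (z := x).
rewrite /conn conn_sym => /(_ rx (mem_head _ _)).
have rR : root (glink eps phi) x \in R.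
  apply/andP; split; last exact: Ar.
  exact: (roots_root (conn_sym eps phi) x).
rewrite !inE => /orP[/eqP E|/eqP E]; apply/orP; [left|right].
  by rewrite -E.
by apply/fintype.imageP; exists (root (glink eps phi) x); rewrite // E epsK.
Qed.

(** * Curvature of a reduced counterexample *)

Section Reduced.
Variables (phi : {perm D}) (lam : D -> edge Gam * bool) (d0 : D).
Hypotheses (ce : counterexample phi lam d0) (nt : no_trivial_face phi d0).
Hypothesis lam_eps : forall x, conn eps phi d0 x -> lam (eps x) <> sinv (lam x).

Local Notation K := (conn eps phi d0).
Local Notation C := (diam (offdiag_product Gam) + 1)%N.

(* The vertex at the origin of [y] has degree other than 1 and 2. *)
Definition branching y := phi (eps (phi (eps y))) != y.

Lemma conn0_phi x : K x -> K (phi x).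
Proof. by move=> Kx; exact: connect_trans Kx (conn_phi _ _ _). Qed.

Lemma conn0_eps x : K x -> K (eps x).
Proof. by move=> Kx; exact: connect_trans Kx (conn_eps _ _ _). Qed.

Lemma lift_dart x : K x -> elab (lam x) = l x /\ tgt (lam x) = src (lam (phi x)).
Proof.
move=> Kx; have [a fa] := face_exists phi x.
have [v [/reads_cons[sx ex ra] _]] := kind_of_face ce nt Kx (mem_head _ _) fa.
split=> //; move: fa ra; rewrite face_cons => /and3P[_].
case: a => [_ /= /eqP-> [/eqP-> _] //|y a /= /andP[/eqP-> _] _].
by case/reads_cons => ->.
Qed.

(** At a leaf, [lam (eps y)] and [sinv (lam y)] have the same label and the same terminus, so they
    agree as [Gam] is folded, against [lam_eps]. *)
Lemma vertex_not_leaf y : K y -> phi (eps y) != y.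
Proof.
move=> Ky; apply/eqP => E; case: (lam_eps Ky).
have [e1 t1] := lift_dart Ky; have [e2 t2] := lift_dart (conn0_eps Ky).
rewrite E in t2; case: GH => _ fG _ _.
have [//|ne] := eqVneq (lam (eps y)) (sinv (lam y)).
have [_] : src (lam (eps y)) != src (sinv (lam y)) /\ tgt (lam (eps y)) != tgt (sinv (lam y)).
  by apply: folded_neq => //; rewrite elab_sinv e1 e2 l_eps.
by rewrite tgt_sinv t2 eqxx.
Qed.

Lemma path_conn0 x s : K x -> fpath phi x s -> {in x :: s, forall y, K y}.
Proof.
move=> Kx ps y; rewrite inE => /orP[/eqP->//|ys].
have [n En] := fpathP ps; move: ys; rewrite En => /trajectP[i _ ->].
by rewrite -iterSr; elim: i.+1 => //= j; exact: conn0_phi.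
Qed.

Lemma path_lift x s : K x -> fpath phi x s ->
  is_path (src (lam x)) (map lam (x :: s)) (tgt (lam (last x s))).
Proof.
elim: s x => [|y s IH] x Kx /=; first by rewrite !eqxx.
case/andP => /eqP <- /(IH _ (conn0_phi Kx)) /=.
by have [_ ->] := lift_dart Kx; rewrite !eqxx.
Qed.

(** At a non-branching vertex the walk on the other side of the edges also passes from one dart to
    the next, backwards. The inverted lifts of the opposite darts thus form a second path, with the
    same labels. *)
Lemma path_lift_opposite x s : K x -> fpath phi x s -> ~~ has branching s ->
  is_path (tgt (lam (eps x))) (map (fun y => sinv (lam (eps y))) (x :: s))
    (src (lam (eps (last x s)))).
Proof.
elim: s x => [|y s IH] x Kx; first by rewrite /= src_sinv tgt_sinv !eqxx.
rewrite [path _ _ _]/= [has _ _]/= => /andP[/eqP Ey ps] /norP[nb nbs].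
have Ky : K y by rewrite -Ey; exact: conn0_phi.
have Exy : phi (eps y) = eps x.
  by apply: (can_inj epsK); rewrite epsK; apply: (@perm_inj _ phi); rewrite Ey (eqP (negbNE nb)).
have E : src (lam (eps x)) = tgt (lam (eps y)).
  by have [_ ->] := lift_dart (conn0_eps Ky); rewrite Exy.
apply/andP; split; first by rewrite src_sinv.
by rewrite tgt_sinv E; exact: IH.
Qed.

(** The walk is cut at the branching darts of [s]. Along each piece the lifts on the two sides have
    the same labels and differ at every dart, by [lam_eps], so [piece_rl_le] bounds it by [C]. *)
Lemma slabel_le x s : K x -> fpath phi x s ->
  rl_le Gam (slabel (x :: s)) ((count branching s).+1 * C).
Proof.
have [n] := ubnP (size s); elim: n x s => // n IH x s lt_n Kx ps.
have [hb|nb] := boolP (has branching s); last first.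
  have -> : count branching s = 0%N by move: nb; rewrite has_count -leqNgt leqn0 => /eqP.
  rewrite mul1n; have Ks := path_conn0 Kx ps.
  have <- : path_label (map lam (x :: s)) = slabel (x :: s).
    rewrite path_labelE -map_comp; congr wlabel; apply/eq_in_map => y /Ks Ky.
    by case: (lift_dart Ky).
  case: GH => _ fG _ _.
  apply: piece_rl_le fG _ (path_lift Kx ps) (path_lift_opposite Kx ps nb).
  elim: (x :: s) Ks => //= y t IHt Ks.
  have Ky : K y by apply: Ks; exact: mem_head.
  rewrite IHt ?andbT => [|z zt]; last by apply: Ks; rewrite inE zt orbT.
  have [e1 _] := lift_dart Ky; have [e2 _] := lift_dart (conn0_eps Ky).
  rewrite /off_pair elab_sinv e1 e2 l_eps sinvK eqxx /=.
  by apply/eqP => E; case: (lam_eps Ky); rewrite E sinvK.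
case/hasP: hb => y ys by_; case/path.splitPr: ys ps lt_n => s1 s2.
rewrite cat_path size_cat /= => /and3P[p1 /eqP Ey p2] lt_n.
have Ky : K y.
  by rewrite -Ey; apply: conn0_phi; apply: (path_conn0 Kx p1); exact: mem_last.
rewrite -cat_cons slabel_cat count_cat /= by_ add1n addnS -addSn -addnS mulnDl.
by apply: rl_leM; apply: IH => //; lia.
Qed.

Hypothesis gamma_large : le_ext (6 * C + 2 * diam Gam) (gamma Gam N).

(** Conjugated to the base point by a path of length at most [diam Gam], the label of the face is a
    nontrivial element of [N]. As [C] is positive, [gamma_large] forces at least six pieces. *)
Lemma six_branching s d : K d -> d \in s -> face phi s -> d0 \notin s ->
  (6 <= count branching s)%N.
Proof.
move=> Kd ds fs d0s.
have key x t : face phi (x :: t) -> d \in x :: t -> d0 \notin x :: t ->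
    (6 <= (count branching t).+1)%N.
  move=> ft dt d0t; have := kind_of_face ce nt Kd dt ft; rewrite d0t.
  case=> v [_ [_ /(_ isT) Nv]]; have [p0 /diamP[p [pv lep]]] := N_at_exists v.
  have Kx : K x by apply: connect_trans Kd (face_conn _ ft dt (mem_head _ _)).
  have pt : fpath phi x t by move: ft; rewrite face_cons => /and3P[].
  have Nn := N_at_path pv Nv; set n := _ * _ in Nn.
  have n1 : n <> 1.
    move=> n1; apply: (nt Kd dt ft).
    have := congr1 (fun g => (path_label p)^-1 * g * path_label p) n1.
    by rewrite /n mulg1 mulVg !mulgA mulVg mul1g mulgKV.
  have rn : rl_le Gam n (diam Gam + (count branching t).+1 * C + diam Gam).
    apply: rl_leM; first apply: rl_leM; last 2 first.
    - exact: slabel_le.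
    - rewrite -path_label_winv; apply: rl_leW (rl_le_path _).
      by rewrite /winv size_rev size_map.
    exact: rl_leW lep (rl_le_path _).
  have := gamma_le Nn n1 rn gamma_large; set c := (count _ _).+1; nia.
(* Read from a branching dart [y], the face has as many pieces as branching darts. With no branching
   dart it would be a single piece, against the bound. *)
have [hb|nb] := boolP (has branching s).
  case/hasP: hb => y ys by_; case/path.splitPr: ys fs ds d0s => s1 s2 fs ds d0s.
  have fr : face phi (y :: s2 ++ s1) by rewrite -cat_cons face_rot.
  have := key _ _ fr; rewrite count_cat [in X in _ -> X]count_cat /= by_.
  have E z : (z \in y :: s2 ++ s1) = (z \in s1 ++ y :: s2).
    by rewrite -cat_cons !mem_cat orbC.
  by rewrite !E => /(_ ds d0s); lia.
case: s ds fs d0s nb => // x t ds fs d0s /= /norP[_ nb].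
have := key x t fs ds d0s; move: nb; rewrite has_count; lia.
Qed.

Lemma conn0_phiE x : K (phi x) = K x.
Proof.
apply/idP/idP; last exact: conn0_phi.
by move=> Kx; apply: connect_trans Kx _; rewrite conn_sym; exact: conn_phi.
Qed.

Lemma conn0_epsE x : K (eps x) = K x.
Proof. by apply/idP/idP => [/conn0_eps|]; [rewrite epsK|exact: conn0_eps]. Qed.

(* Corners at branching vertices get total weight 3, other corners of the
   component of [d0] weight 3 as well, and the darts of the isolated edges
   weight 9; every vertex and every face but the one of [d0] collects 6. *)
Definition face_weight d := if K d then branching d : nat else 3.
Definition vertex_weight d := if K d then (if branching d then 2 else 3) else 6.

Lemma reduced_absurd : False.
Proof.
(* Isolating all edges outside the component of [d0] makes their contribution to Euler's formula
   explicit. *)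
have [||psi [plp outp inp]] := isolate epsK (A := predC K) ce.1.
- by move=> x /=; rewrite conn0_phiE.
- by move=> x /=; rewrite conn0_epsE.
have {}outp x : K x -> psi x = phi x by move=> Kx; apply: outp; rewrite /= Kx.
have Kpsi x : K (psi x) = K x.
  case Kx: (K x); first by rewrite outp ?conn0_phiE.
  by rewrite inp /= ?Kx // conn0_epsE.
have x_eps x : uniq [:: x; eps x] by rewrite /= inE eq_sym eps_neq.
have F x : (6 <= \sum_(d in porbit psi x) (face_weight d + 6 * (d == d0)))%N.
  have [Kx|Kx] := boolP (K x); last first.
    apply: leq_trans (sum_seq_le _ (x_eps x) _); last first.
      move=> y; rewrite !inE => /orP[]/eqP->; first exact: porbit_id.
      by rewrite -inp // (mem_porbit _ 1).
    by rewrite !big_cons big_nil /face_weight conn0_epsE (negbTE Kx); lia.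
  have [a fa] := face_exists phi x.
  have Ka y : y \in x :: a -> K y.
    by move=> ya; apply: connect_trans Kx (face_conn _ fa (mem_head _ _) ya).
  have fa' : face psi (x :: a) by apply: (face_eq _ fa) => y /Ka; exact: outp.
  have sub : {subset x :: a <= porbit psi x}.
    by move=> y ya; apply: face_porbit fa' ya (mem_head _ _).
  have [d0a|d0a] := boolP (d0 \in x :: a).
    apply: leq_trans (sum_seq_le (s := [:: d0]) _ _ _) => //.
      by rewrite big_cons big_nil eqxx; lia.
    by move=> y; rewrite inE => /eqP->; exact: sub.
  apply: leq_trans (sum_seq_le _ _ sub); last by case/andP: fa.
  apply: leq_trans (six_branching Kx (mem_head _ _) fa d0a) _.
  rewrite -sum1_count big_mkcond big_seq [X in (_ <= X)%N]big_seq.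
  by apply: leq_sum => d /Ka Kd; rewrite /face_weight Kd; case: branching.
have V x : (6 <= \sum_(d in porbit (vperm eps psi) x) vertex_weight d)%N.
  have [Kx|Kx] := boolP (K x); last first.
    apply: leq_trans (sum_seq_le (s := [:: x]) _ _ _) => //.
      by rewrite big_cons big_nil /vertex_weight (negbTE Kx).
    by move=> y; rewrite inE => /eqP->; exact: porbit_id.
  have nuE y : K y -> vperm eps psi y = phi (eps y).
    by move=> Ky; rewrite permM outp // conn0_epsE.
  pose y := phi (eps x); pose z := phi (eps y).
  have Ky : K y by rewrite conn0_phiE conn0_epsE.
  have Kz : K z by rewrite conn0_phiE conn0_epsE.
  have yP : y \in porbit (vperm eps psi) x by rewrite /y -nuE // (mem_porbit _ 1).
  have zP : z \in porbit (vperm eps psi) x.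
    by rewrite /z -nuE // /y -nuE // -permM (mem_porbit _ 2).
  have yx : y != x by exact: vertex_not_leaf.
  have zy : z != y by exact: vertex_not_leaf.
  (* A branching vertex has three distinct darts [x], [y], [z] of weight at least 2. Otherwise [y]
     does not branch either, and [x] and [y] weigh 3 each. *)
  have [bx|bx] := boolP (branching x).
    have zx : z != x := bx.
    apply: leq_trans (sum_seq_le (s := [:: x; y; z]) _ _ _).
    - rewrite !big_cons big_nil /vertex_weight Kx Ky Kz.
      by do 3!case: (branching _).
    - by rewrite /= !inE !negb_or (eq_sym x y) (eq_sym x z) (eq_sym y z) yx zx zy.
    - by move=> u; rewrite !inE => /or3P[]/eqP-> //; exact: porbit_id.
  have by_ : ~~ branching y.
    by move: bx; rewrite /branching !negbK => /eqP E; rewrite /y E eqxx.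
  apply: leq_trans (sum_seq_le (s := [:: x; y]) _ _ _).
  - by rewrite !big_cons big_nil /vertex_weight Kx Ky (negbTE bx) (negbTE by_).
  - by rewrite /= inE eq_sym yx.
  - by move=> u; rewrite !inE => /orP[]/eqP-> //; exact: porbit_id.
have E x : (2 <= \sum_(d in porbit eps x) 1)%N.
  apply: leq_trans (sum_seq_le _ (x_eps x) _); first by rewrite !big_cons big_nil.
  move=> y; rewrite !inE => /orP[]/eqP->; first exact: porbit_id.
  exact: (mem_porbit _ 1).
have := orbn_weight F; have := orbn_weight V.
have {}E : (2 * orbn eps <= #|D|)%N by rewrite -sum1_card; exact: orbn_weight E.
have := card_le_ncomp (connect0 _ d0) Kpsi conn0_epsE inp.
have sumW : (\sum_d (face_weight d + 6 * (d == d0)) + \sum_d vertex_weight d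
    = 3 * #|D| + 6 * #|[predC K]| + 6)%N.
  have E6 : (6 = \sum_d 6 * (d == d0))%N.
    by rewrite -big_distrr (bigD1 d0) //= eqxx big1 // => i /negbTE->.
  rewrite [X in _ = (_ + X)%N]E6 -sum1_card -[#|[predC K]|]sum1_card big_distrr
    [X in (_ + X + _)%N]big_distrr.
  rewrite [X in (_ + X + _)%N]big_mkcond -!big_split; apply: eq_bigr => d _ /=.
  rewrite /face_weight /vertex_weight (_ : (d \in [predC K]) = ~~ K d) //.
  by case: (K d); case: (branching d) => /=; lia.
(* For [psi], with F faces, V vertices, E edges, c components and P darts outside [K]:
   [6F + 6V <= 3|D| + 6P + 6], [2E <= |D|] and [P + 2 <= 2c] contradict [F + V + E = |D| + 2c]. *)
move: plp; rewrite /planar; move: E sumW.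
set x1 := bigop _ _ _; set x2 := bigop _ _ _; set x3 := #|D|; set x4 := #|_|.
lia.
Qed.
End Reduced.

(** Descent on the size of the component: a counterexample which no surgery makes smaller is refuted
    by [reduced_absurd]. *)
Lemma no_counterexample phi lam d0 :
    le_ext (6 * (diam (offdiag_product Gam) + 1) + 2 * diam Gam) (gamma Gam N) ->
  ~ counterexample phi lam d0.
Proof.
move=> large; have [n] := ubnP (csize phi d0).
elim: n phi lam d0 => // n IH phi lam d0 lt_n ce.
have smaller : ~ exists phi' lam' d0', counterexample phi' lam' d0' /\
    (csize phi' d0' < csize phi d0)%N.
  by move=> [phi' [lam' [d0' [ce' lt]]]]; apply: IH ce'; lia.
have nt : no_trivial_face phi d0.
  by move=> d s cd ds fs s1; apply: smaller; exact: remove_trivial_face ce cd ds fs s1.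
apply: (reduced_absurd ce nt _ large) => x cx lamx.
by apply: smaller; exact: cancel_edge ce nt cx lamx.
Qed.

(** * Construction of the diagram *)

(** A map under construction: [s] is the unfinished face, [rem] has one dart of each isolated edge
    reserved for later, and all other faces are good. *)
Definition partial_diagram lam phi s (rem : seq D) : Prop :=
  [/\ planar eps phi, face phi s, uniq rem /\ {in rem, forall y, eps y \notin rem},
    {in rem, forall y, [/\ phi y = eps y, phi (eps y) = y, y \notin s & eps y \notin s]}
  & forall d, d \in s \/ exists t, [/\ d \in t, face phi t & good lam t]].

Definition opp s := rev (map eps s).

Lemma slabel_opp s : slabel (opp s) = (slabel s)^-1.
Proof.
rewrite /slabel -wlabel_winv; congr wlabel.
rewrite /winv /opp map_rev -!map_comp; congr rev; apply/eq_map => x; exact: l_eps.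
Qed.

Lemma diagram_start lam ys : uniq ys -> {in ys, forall y, eps y \notin ys} ->
  partial_diagram lam eps [::] ys.
Proof.
move=> us dis; split=> //.
- rewrite /planar; have -> : vperm eps eps = 1%g by apply/permP => x; rewrite permM perm1 epsK.
  rewrite orbn1; suff -> : ncomp eps eps = orbn eps.
    by rewrite -addnn; lia.
  rewrite orbn_fcard /ncomp; apply: eq_n_comp => u v.
  by apply: eq_connect => {u v} u v /=; rewrite orbb.
- by move=> d; right; exists [:: d; eps d]; split; [exact: mem_head| |left];
    [rewrite face_cons /= inE eq_sym eps_neq epsK !eqxx
    |rewrite !slabel_cons l_eps letter_sinv /slabel /= wlabel_nil mulg1 mulgV].
Qed.

Lemma diagram_attach_edge lam phi s t y rem :
    partial_diagram lam phi (s ++ t) (y :: rem) ->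
  exists phi', partial_diagram lam phi' (s ++ [:: y; eps y] ++ t) rem.
Proof.
case=> pl fs [/= /andP[yr ur] er] isor gd; have [Ey Ey' ys ys'] := isor y (mem_head _ _).
have [phi' [pl' fs' out]] := attach_edge epsK eps_neq pl fs Ey Ey' ys ys'.
have mem z : (z \in s ++ [:: y; eps y] ++ t) = (z \in s ++ t) || (z \in [:: y; eps y]).
  by rewrite !mem_cat; case: (z \in s); case: (z \in t); rewrite ?orbT ?orbF.
have fy : face phi [:: y; eps y].
  by rewrite face_cons /= inE eq_sym eps_neq Ey Ey' !eqxx.
have eyr : eps y \notin rem by have := er y (mem_head _ _); rewrite inE => /norP[].
have ny z : z \in rem -> z \notin [:: y; eps y] /\ eps z \notin [:: y; eps y].
  move=> zr; have zy : z != y by apply: contraNneq yr => <-.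
  have zy' : z != eps y by apply: contraNneq eyr => <-.
  rewrite !inE !negb_or zy zy' (inj_eq (can_inj epsK)) zy andbT; split=> //.
  by rewrite andbT; apply: contraNneq zy' => <-; rewrite epsK.
exists phi'; split=> //.
- by split=> // z zr; have := er z; rewrite !inE zr orbT => /(_ isT) /norP[].
- move=> z zr; have [nz nz'] := ny z zr.
  have [|Ez Ez' zs zs'] := isor z; first by rewrite inE zr orbT.
  have zo : z \notin s ++ [:: y; eps y] ++ t by rewrite mem negb_or zs.
  have zo' : eps z \notin s ++ [:: y; eps y] ++ t by rewrite mem negb_or zs'.
  by rewrite !out.
move=> d; have [ds|ds] := boolP (d \in s ++ [:: y; eps y] ++ t); [by left|right].
move: ds; rewrite mem negb_or => /andP[ds dy].
have [|[u [du fu gu]]] := gd d; first by rewrite (negbTE ds).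
exists u; split=> //; apply: (face_eq _ fu) => z zu; apply: out.
by rewrite mem negb_or (face_disj fs fu du ds zu) (face_disj fy fu du dy zu).
Qed.

(** Each edge is attached at the tip of the preceding one, so [u] grows as a hair inside the
    face. *)
Lemma diagram_attach_segment lam phi s t u rem :
    partial_diagram lam phi (s ++ t) (u ++ rem) ->
  exists phi', partial_diagram lam phi' (s ++ u ++ opp u ++ t) rem.
Proof.
elim: u phi s t => [|y u IH] phi s t; first by exists phi.
case/diagram_attach_edge => phi1; rewrite /= -cat_rcons => /IH[phi2 pd].
by exists phi2; move: pd; rewrite /opp /= rev_cons !cat_rcons.
Qed.

Lemma split_off phi s u t : planar eps phi -> face phi (s ++ u ++ t) ->
  exists phi', [/\ planar eps phi', face phi' u, face phi' (s ++ t)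
    & forall z, z \notin s ++ u ++ t -> phi' z = phi z].
Proof.
move=> pl; rewrite face_rot -catA => fs.
case Eu: u fs => [|x u'] fs; first by exists phi; split=> //; rewrite face_rot.
case Et: (t ++ s) fs => [|w t'] fs.
  have [-> ->] : t = [::] /\ s = [::] by case: (t) (s) Et => [|? ?] [|? ?].
  by exists phi; split=> //; move: fs; rewrite cats0.
have [f1 f2 out] := face_split fs.
have xc : x \in x :: u' ++ w :: t' by rewrite mem_head.
have wc : w \in x :: u' ++ w :: t' by rewrite !(inE, mem_cat) eqxx !orbT.
exists (twist phi x w); split=> //.
- apply: planar_split; rewrite ?(face_porbit fs xc wc) //.
  by case/andP: fs => /=; rewrite mem_cat inE !negb_or => /andP[/and3P[]].
- by rewrite face_rot Et.
by move=> z; rewrite mem_cat orbC -mem_cat -catA Et; exact: out.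
Qed.

Lemma diagram_split lam phi s u t rem : partial_diagram lam phi (s ++ u ++ t) rem ->
    good lam u ->
  exists phi', partial_diagram lam phi' (s ++ t) rem.
Proof.
case=> pl fs ur isor gd gu; have [phi' [pl' fu fst out]] := split_off pl fs.
have mem z : (z \in s ++ u ++ t) = (z \in s ++ t) || (z \in u).
  by rewrite !mem_cat; case: (z \in s); case: (z \in t); rewrite ?orbT ?orbF.
exists phi'; split=> //.
  move=> z /isor[Ez Ez' zs zs']; rewrite !out //.
  by move: zs zs'; rewrite !mem !negb_or => /andP[-> _] /andP[-> _].
move=> d; have [ds|ds] := boolP (d \in s ++ t); [by left|right].
have [du|du] := boolP (d \in u); first by exists u.
have {}ds : d \notin s ++ u ++ t by rewrite mem negb_or ds.
have [|[v [dv fv gv]]] := gd d; first by rewrite (negbTE ds).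
exists v; split=> //; apply: (face_eq _ fv) => z zv; apply: out.
exact: face_disj fs fv dv ds zv.
Qed.

Lemma reads_good lam s : reads lam b s b -> N (slabel s) -> good lam s.
Proof. by move=> rs Ns; right; exists b; split=> //; split=> // _; exact/N_at_base. Qed.

(** For a block [(g, r)] a hair labelled [g r] turns the boundary into [s g r r^-1 g^-1]; splitting
    off the good face [r] leaves [s g r^-1 g^-1], whence the inverse in each conjugate. *)
Lemma diagram_blocks lam phi s (bl : seq (seq D * seq D)) rem :
    partial_diagram lam phi s (flatten [seq c.1 ++ c.2 | c <- bl] ++ rem) ->
    (forall c, c \in bl -> good lam c.2) ->
  exists phi' s', partial_diagram lam phi' s' rem /\
    slabel s' = slabel s * \prod_(c <- bl) (slabel c.1 * (slabel c.2)^-1 * (slabel c.1)^-1).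
Proof.
elim: bl phi s => [|[g r] bl IH] phi s.
  by move=> pd _; exists phi, s; rewrite big_nil mulg1.
rewrite /= -catA -{1}[s]cats0 => /diagram_attach_segment[phi1].
rewrite cats0 -[(g ++ r) ++ _]catA => pd gbl.
have {pd} : partial_diagram lam phi1 ((s ++ g) ++ r ++ opp (g ++ r))
    (flatten [seq c.1 ++ c.2 | c <- bl] ++ rem) by rewrite -!catA.
move=> /diagram_split /(_ (gbl (g, r) (mem_head _ _)))[phi2 pd].
have [|phi3 [s3 [pd3 E3]]] := IH phi2 _ pd; first by move=> c cbl; apply: gbl; rewrite inE cbl orbT.
exists phi3, s3; split=> //; rewrite E3 big_cons !slabel_cat slabel_opp slabel_cat invMg.
by rewrite /= !mulgA.
Qed.

(** A last hair gives the face [s, u, opp u]. Splitting off [u] creates the bad face, and the rest,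
    [s, opp u], has trivial label. *)
Lemma diagram_close lam phi s u d : partial_diagram lam phi s u -> d \in u ->
    reads lam b u b -> ~ N (slabel u) -> slabel s = slabel u ->
  exists phi', counterexample phi' lam d.
Proof.
move=> pd du ru nu su; rewrite -[s]cats0 -[u]cats0 in pd.
have [phi1 [pl fs _ _ gd]] := diagram_attach_segment pd.
rewrite !cats0 in fs gd; have [phi2 [pl2 f1 f2 out]] := split_off pl fs.
exists phi2; split=> //; exists u; split=> //.
  by exists b; split=> //; split=> // /N_at_base.
move=> e _ eu; have [es|es] := boolP (e \in s ++ opp u).
  by exists (s ++ opp u); split=> //; left; rewrite slabel_cat slabel_opp su mulgV.
have {}es : e \notin s ++ u ++ opp u.
  by move: es eu; rewrite !mem_cat !negb_or => /andP[-> ->] ->.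
have [|[v [ev fv gv]]] := gd e; first by rewrite (negbTE es).
exists v; split=> //; apply: (face_eq _ fv) => z zv; apply: out.
exact: face_disj fs fv ev es zv.
Qed.

End NormalPart.

(** * Normal closures as products of conjugates *)

Section NormalClosure.
Variables (G : groupType) (N : set G).
Hypothesis N_subgroup : is_subgroup N.
Local Open Scope group_scope.

Definition conj_prod (bl : seq (G * G)) : G :=
  \prod_(c <- bl) (c.1 * c.2^-1 * c.1^-1).

Lemma normal_closure_prod w : normal_closure N w ->
  exists2 bl, (forall c, c \in bl -> N c.2) & w = conj_prod bl.
Proof.
case: N_subgroup => N1 NM NV.
pose M := [set w | exists2 bl, (forall c, c \in bl -> N c.2) & w = conj_prod bl].
suff [nM sM] : is_normal_in M [set: G] /\ N `<=` M by move/(_ M (conj nM sM)).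
split; last first.
  move=> x Nx; exists [:: (1, x^-1)]; first by move=> c; rewrite inE => /eqP->; exact: NV.
  by rewrite /conj_prod big_cons big_nil /= invgK mul1g invg1 !mulg1.
split=> //.
  split.
  - by exists [::] => //; rewrite /conj_prod big_nil.
  - move=> x y [bx Nx ->] [by_ Ny ->]; exists (bx ++ by_); last by rewrite /conj_prod big_cat.
    by move=> c; rewrite mem_cat => /orP[/Nx|/Ny].
  - move=> x [bl Nbl ->]; exists (rev [seq (c.1, c.2^-1) | c <- bl]).
      by move=> c; rewrite mem_rev => /mapP[c' /Nbl /NV ? ->].
    elim: bl {Nbl} => [|c bl IH]; first by rewrite /conj_prod /= !big_nil invg1.
    rewrite /conj_prod big_cons invMg [X in X * _]IH /= rev_cons -cats1 /conj_prod big_cat.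
    by rewrite big_cons big_nil /= mulg1 !invMg !invgK !mulgA.
move=> x h [bl Nbl ->] _; exists [seq (h^-1 * c.1, c.2) | c <- bl].
  by move=> c /mapP[c' /Nbl ? ->].
elim: bl {Nbl} => [|c bl IH]; first by rewrite /conj_prod /= !big_nil conj1g.
rewrite /conj_prod /= !big_cons conjMg [X in _ * X]IH; congr (_ * _).
by rewrite conjgE /= invMg invgK !mulgA.
Qed.
End NormalClosure.

Section Blocks.
Variables (A B : Type) (f : A -> B).

Lemma map_eq_cat (ys : seq A) s t : map f ys = s ++ t ->
  exists ys1 ys2, [/\ ys = ys1 ++ ys2, map f ys1 = s & map f ys2 = t].
Proof.
move=> E; exists (take (size s) ys), (drop (size s) ys).
by rewrite cat_take_drop map_take map_drop E take_size_cat // drop_size_cat.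
Qed.

Lemma map_eq_flatten (bl : seq (seq B * seq B)) ys t :
    map f ys = flatten [seq c.1 ++ c.2 | c <- bl] ++ t ->
  exists bl' t', [/\ ys = flatten [seq c.1 ++ c.2 | c <- bl'] ++ t',
    map (fun c => (map f c.1, map f c.2)) bl' = bl & map f t' = t].
Proof.
elim: bl ys => [|[g r] bl IH] ys /=; first by exists [::], ys.
rewrite -!catA => /map_eq_cat[y1 [ys' [-> Eg /map_eq_cat[y2 [ys2 [-> Er]]]]]].
move=> /IH[bl' [t' [-> Eb Et]]]; exists ((y1, y2) :: bl'), t'.
by rewrite /= Eg Er Eb -!catA.
Qed.
End Blocks.

(** * The diagram of an element of the normal closure *)

Section Diagram.
Variables (X : choiceType) (Gam : xdigraph X) (b : vert Gam).
Variables (H N : set (freeGroup X)).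
Hypotheses (NH : is_normal_in N H) (GH : is_stallings_graph b H).
Local Open Scope group_scope.
Local Notation item := ((X * bool) * (edge Gam * bool))%type.

(** Each relator lies in [H] and is read along a cycle at [b]. The conjugating words get the
    arbitrary lift [e0], as they will only border a face with trivial label. *)
Lemma item_blocks (e0 : edge Gam * bool) (bl : seq (freeGroup X * freeGroup X)) :
    (forall c, c \in bl -> N c.2) ->
  exists2 bl' : seq (seq item * seq item),
    (forall c, c \in bl' -> exists p, [/\ is_path b p b, N (path_label p)
        & c.2 = map (fun a => (elab a, a)) p])
    & conj_prod bl = conj_prod
        [seq (wlabel (map fst c.1), wlabel (map fst c.2)) | c <- bl'].
Proof.
elim: bl => [|[g r] bl IH] Nbl; first by exists [::].
have [c cbl|bl' Nbl' E] := IH; first by apply: Nbl; rewrite inE cbl orbT.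
have Nr : N r by exact: Nbl (mem_head _ _).
case: GH => _ _ EH _; have : H r by case: NH => _ + _; apply.
rewrite EH => -[p [pb _ pr]].
exists ((map (fun x => (x, e0)) (val g), map (fun a => (elab a, a)) p) :: bl').
  move=> c; rewrite inE => /orP[/eqP->|/Nbl'//]; exists p; split=> //; by rewrite pr.
rewrite /conj_prod /= !big_cons -/(conj_prod _) E; congr (_ * _).
rewrite /= -!map_comp (_ : map _ (sval g) = val g); last exact: map_id.
by rewrite wlabel_val -[X in wlabel X]/(map elab p) -path_labelE pr.
Qed.

Lemma counterexample_exists w : H w -> ~ N w -> normal_closure N w ->
  exists (D : finType) (eps : {perm D}) (l : D -> X * bool),
    [/\ involutive eps, forall x, eps x != x, forall x, l (eps x) = sinv (l x)
      & exists phi lam d, counterexample b N eps l phi lam d].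
Proof.
move=> Hw Nw cw; have Nsub : is_subgroup N by case: NH.
have [bl Nbl Ew] := normal_closure_prod Nsub cw.
have EH : H = cycle_labels b by case: GH.
move: (Hw); rewrite EH => -[pu [pub _ puw]].
(* The cycle of [w] must have an edge, to provide a default lift and a base dart. *)
have pun : pu <> [::].
  by move=> E; case: Nw; rewrite -puw E path_label_nil; case: Nsub.
have [e0 _] : exists e0 : edge Gam * bool, true by case: (pu) pun => // e0; exists e0.
have [B NB EB] := item_blocks e0 Nbl.
(* Darts are the signed positions of [T], which lists all blocks and then the cycle of [w]. A
   positive dart carries the item at its position; negative darts get a lift that is never read, as
   they end on a face with trivial label. *)
pose U : seq item := map (fun a => (elab a, a)) pu.
pose T := flatten [seq c.1 ++ c.2 | c <- B] ++ U.
pose D := ('I_(size T) * bool)%type.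
pose flip (d : D) : D := (d.1, ~~ d.2).
have flipK : involutive flip by case=> i s; rewrite /flip /= negbK.
pose eps : {perm D} := perm (can_inj flipK).
pose f (d : D) := tnth (in_tuple T) d.1.
pose l (d : D) := if d.2 then (f d).1 else sinv (f d).1.
pose lam (d : D) := (f d).2.
have epsE d : eps d = flip d by exact: permE.
have epsK : involutive eps by move=> d; rewrite !epsE flipK.
have eps_neq d : eps d != d.
  by rewrite epsE; case: d => i s; apply/eqP => -[]; case: s.
have l_eps d : l (eps d) = sinv (l d).
  by rewrite epsE /l /f /flip /=; case: d => i [] //=; rewrite sinvK.
exists D, eps, l; split=> //.
pose ys : seq D := [seq (i, true) | i <- enum 'I_(size T)].
have uys : uniq ys by rewrite map_inj_uniq ?enum_uniq // => i j [].
have ysP d : d \in ys -> d.2 by case/mapP => i _ ->.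
have eys : {in ys, forall y, eps y \notin ys}.
  by move=> y /ysP y2; apply/negP => /ysP; rewrite epsE /= y2.
have Efys : map f ys = T by rewrite -map_comp; exact: map_tnth_enum.
have [bl' [us [Eys Ebl Eus]]] := map_eq_flatten Efys.
have lE d : d \in ys -> l d = (f d).1 by rewrite /l => /ysP ->.
have slabelE s : {subset s <= ys} -> slabel l s = wlabel (map fst (map f s)).
  by move=> sy; rewrite /slabel -map_comp; congr wlabel; apply/eq_in_map => d /sy /lE.
have readsE s p : {subset s <= ys} -> map f s = map (fun a => (elab a, a)) p ->
    is_path b p b -> reads l lam b s b /\ slabel l s = path_label p.
  move=> sy Ef pb; split; last by rewrite slabelE // Ef -map_comp path_labelE.
  split.
    have -> : map lam s = map snd (map f s) by rewrite -map_comp.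
    by rewrite Ef -map_comp map_id.
  move=> d ds; rewrite lE ?sy //; have : f d \in map f s by exact: map_f.
  by rewrite Ef => /mapP[a _ Ea]; rewrite /lam Ea.
have sub_us : {subset us <= ys} by move=> d ds; rewrite Eys mem_cat ds orbT.
have sub_bl c : c \in bl' -> {subset c.1 ++ c.2 <= ys}.
  move=> cb d dc; rewrite Eys mem_cat; apply/orP; left; apply/flattenP.
  by exists (c.1 ++ c.2) => //; apply/mapP; exists c.
have [ru su] := readsE us pu sub_us Eus pub.
have pd := diagram_start b N epsK eps_neq l_eps lam uys eys.
rewrite Eys in pd.
have [|phi [s [pds Es]]] := diagram_blocks epsK eps_neq l_eps pd.
  move=> c cb; have cB : (map f c.1, map f c.2) \in B.
    by rewrite -Ebl; apply/mapP; exists c.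
  have [p [pb Np Ep]] := NB _ cB.
  have [|rc sc] := readsE c.2 p _ Ep pb.
    by move=> d dc; apply: (sub_bl c cb); rewrite mem_cat dc orbT.
  by apply: (reads_good NH GH rc); rewrite sc.
have [d dus] : exists d, d \in us.
  case: (us) Eus => [|d us' _]; last by exists d; exact: mem_head.
  by rewrite /U; case: (pu) pun.
have [||phi' ce] := diagram_close NH GH epsK eps_neq l_eps pds dus ru.
- by rewrite su puw.
- rewrite Es su puw Ew EB -Ebl /conj_prod !big_map /slabel wlabel_nil mul1g.
  apply: eq_big_seq => c cb /=; rewrite -/(slabel l c.1) -/(slabel l c.2) !slabelE //.
    by move=> e ec; apply: (sub_bl c cb); rewrite mem_cat ec orbT.
  by move=> e ec; apply: (sub_bl c cb); rewrite mem_cat ec.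
by exists phi', lam, d.
Qed.
End Diagram.

Theorem mainTheorem3 (X : choiceType) (H N : set (freeGroup X))
    (Gam : xdigraph X) (b : vert Gam)
    (H_subgroup : is_subgroup H) (H_fg : finitely_generated H)
    (N_normal : is_normal_in N H)
    (Gam_H : is_stallings_graph b H) :
  let C := diam (offdiag_product Gam) + 1 in
  le_ext (6 * C + 2 * diam Gam) (gamma Gam N) ->
  N = normal_closure N `&` H.
Proof.
move=> C large; apply/seteqP; split=> w.
  move=> Nw; split; last by case: N_normal => _ + _; apply.
  by move=> M [_ NM]; exact: NM.
case=> cw Hw; apply: contrapT => Nw.
have [D [eps [l [epsK eps_neq l_eps [phi [lam [d ce]]]]]]] :=
  counterexample_exists N_normal Gam_H Hw Nw cw.
exact: (no_counterexample N_normal Gam_H epsK eps_neq l_eps large ce).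
Qed.
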